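(* Let $G$ be a unicyclic graph. Then $G$ has exactly four distinct normalized Laplacian eigenvalues if and only if $G$ is one of: the cycle $C_6$, the cycle $C_7$, the graph $U_2(1)$ obtained from a triangle by attaching one pendant vertex to one of its vertices, or the graph $U_4(1,1,1)$ obtained from a triangle by attaching one pendant vertex to each of its three vertices.
   Context: A unicyclic graph is a connected graph with $n$ vertices and $n$ edges. $C_n$ denotes the cycle on $n$ vertices; a pendant vertex is a vertex of degree $1$. For a graph with adjacency matrix $A$ and diagonal degree matrix $D$ (no isolated vertices), the normalized Laplacian is $\mathcal{L}=I-D^{-1/2}AD^{-1/2}$, and its eigenvalues are the normalized Laplacian eigenvalues. *)

(* Defs.v *)
From HB Require Import structures.
From mathcomp Require Import all_boot all_order all_algebra.
Set Implicit Arguments. Unset Strict Implicit. Unset Printing Implicit Defensive.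
Import Order.TTheory GRing.Theory Num.Theory.
Local Open Scope ring_scope.

Definition simple_graph (n : nat) (e : rel 'I_n) : Prop :=
  symmetric e /\ irreflexive e.

Definition edges (n : nat) (e : rel 'I_n) : {set {set 'I_n}} :=
  [set [set x; y] | x in 'I_n, y in 'I_n & e x y].

Definition connected_graph (n : nat) (e : rel 'I_n) : Prop :=
  forall x y : 'I_n, connect e x y.

Definition unicyclic (n : nat) (e : rel 'I_n) : Prop :=
  simple_graph e /\ connected_graph e /\ #|edges e| = n.

Definition deg (n : nat) (e : rel 'I_n) (x : 'I_n) : nat := #|[set y | e x y]|.

Definition adj_mx (R : nzRingType) (n : nat) (e : rel 'I_n) : 'M[R]_n :=
  \matrix_(i, j) (e i j)%:R.

Definition deg_mx (R : nzRingType) (n : nat) (e : rel 'I_n) : 'M[R]_n :=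
  diag_mx (\row_i (deg e i)%:R).

Definition deg_isqrt_mx (R : rcfType) (n : nat) (e : rel 'I_n) : 'M[R]_n :=
  diag_mx (\row_i (Num.sqrt (deg e i)%:R)^-1).

Definition norm_lap (R : rcfType) (n : nat) (e : rel 'I_n) : 'M[R]_n :=
  1%:M - deg_isqrt_mx R e *m adj_mx R e *m deg_isqrt_mx R e.

Definition num_distinct_eigenvalues_eq (R : fieldType) (n : nat)
    (M : 'M[R]_n) (k : nat) : Prop :=
  exists s : seq R, [/\ uniq s, size s = k & forall a, eigenvalue M a <-> a \in s].

Definition graph_iso (n m : nat) (e : rel 'I_n) (e' : rel 'I_m) : Prop :=
  exists f : 'I_n -> 'I_m, bijective f /\ forall x y, e' (f x) (f y) = e x y.

Definition graph_of_edges (n : nat) (s : seq (nat * nat)) : rel 'I_n :=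
  fun x y => (((x : nat), (y : nat)) \in s) || (((y : nat), (x : nat)) \in s).

Definition cycle_graph (k : nat) : rel 'I_k :=
  fun x y => ((y : nat) == (x.+1 %% k)%N) || ((x : nat) == (y.+1 %% k)%N).

Definition U2_1 : rel 'I_4 :=
  @graph_of_edges 4 [:: (0,1); (1,2); (0,2); (0,3)]%N.

Definition U4_111 : rel 'I_6 :=
  @graph_of_edges 6 [:: (0,1); (1,2); (0,2); (0,3); (1,4); (2,5)]%N.

(* Main.v *)
(** The normalized Laplacian is similar to [1 - P], where [P = D^-1 A] is the
    random-walk matrix. If it has exactly four eigenvalues, then [P] is
    annihilated by a quartic with simple roots, one of them [1]; the
    [1]-eigenspaces being spanned by the constant and the degree vector, the
    cubic cofactor satisfies [P^3 + a P^2 + b P + c = K (d_z)_{x,z}] with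
    [K <> 0].

    If [x] is a pendant vertex with neighbour [u], the row of [x] says that every
    vertex is within distance 2 of [u] and pins down the degrees around [u].
    Since there are as many edges as vertices, exactly one of three things
    happens: an edge joins two neighbours of [u], an edge joins two vertices at
    distance 2, or one vertex at distance 2 has two common neighbours with [u].
    The last two cases contradict the diagonal entry of the identity at a vertex
    of degree 2, or the row of another pendant vertex. The first case leaves
    only [U2_1] and [U4_111].

    Without pendant vertices all degrees are 2 and the graph is a cycle. The
    identity bounds the diameter by 3, so [n <= 7], and for [n = 3, 4, 5] the
    equation [T_i = T_{n-i}] between Chebyshev polynomials has fewer than four
    roots. The spectra of the four remaining graphs are computed directly. *)

Require Import Defs.
From HB Require Import structures.
From mathcomp Require Import all_boot all_order all_algebra.
From mathcomp Require Import complex ring lra zify.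
Set Implicit Arguments. Unset Strict Implicit. Unset Printing Implicit Defensive.
Import Order.TTheory GRing.Theory Num.Theory.
Local Open Scope ring_scope.

(** * Annihilating polynomials and the cubic identity of the random walk *)

(** Over [R[i]] the matrix is Hermitian, hence unitarily diagonalisable with a real diagonal, and
    [p] vanishes at every diagonal entry. Repeated eigenvalues therefore cost only one factor
    each. *)
Lemma symmetric_mx_annihilated (R : rcfType) (n : nat) (M : 'M[R]_n.+1)
    (s : seq R) :
  M^T = M -> (forall a, eigenvalue M a -> a \in s) ->
  horner_mx M (\prod_(a <- s) ('X - a%:P)) = 0.
Proof.
move=> Msym sP; set p := \prod_(a <- s) _.
pose f := real_complex R; pose A := map_mx f M.
have Aherm : A \is hermsymmx.
  apply: realsym_hermsym.
    by apply/is_hermitianmxP/matrixP => i j; rewrite expr0 scale1r !mxE -[in RHS]Msym mxE.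
  by apply/mxOverP => i j; rewrite mxE; apply/complex_realP; exists (M i j).
have /orthomx_spectralP Adiag := hermitian_normalmx Aherm.
set S := spectralmx A in Adiag; set d := spectral_diag A in Adiag.
have Su : S \in unitmx by exact: spectral_unit.
have SA : S *m A = diag_mx d *m S.
  by rewrite {1}Adiag !mulmxA mulmxV // mul1mx.
have eig i : eigenvalue A (d 0 i).
  apply/eigenvalueP; exists (row i S).
    by rewrite -row_mul SA; apply/rowP => j; rewrite mul_diag_mx !mxE.
  by apply/negP => /eqP r0; have := row_free_unit S; rewrite Su => /row_freeP[B];
     move/(congr1 (row i)); rewrite row_mul r0 mul0mx => /rowP/(_ i);
     rewrite !mxE eqxx => /eqP; rewrite eq_sym oner_eq0.
apply: (map_mx_inj (f := f)); rewrite map_mx0.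
have dp : map_mx (horner (map_poly f p)) d = 0.
  apply/rowP => i; rewrite !mxE.
  have /mxOverP/(_ 0 i)/complex_realP[k dk] := hermitian_spectral_diag_real Aherm.
  have := eig i; rewrite eigenvalue_root_char -map_char_poly -/d dk /root.
  rewrite horner_map fmorph_eq0 => kr.
  have /sP ks : eigenvalue M k by rewrite eigenvalue_root_char.
  have /eqP p0 : root p k by rewrite root_prod_XsubC.
  by rewrite -[k%:C%C]/(f k) horner_map /= p0 rmorph0.
rewrite map_horner_mx -/A.
rewrite Adiag -{2}(invmxK S) horner_mx_uconj ?unitmx_inv // horner_mx_diag dp.
by rewrite (_ : diag_mx 0 = 0) ?mulmx0 ?mul0mx //; apply/matrixP => i j; rewrite !mxE mul0rn.
Qed.

Lemma sum1_deg (R : nzRingType) (n : nat) (e : rel 'I_n) (x : 'I_n) :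
  \sum_(y | e x y) 1 = (deg e x)%:R :> R.
Proof. by rewrite sumr_const /deg cardsE. Qed.

(* Maximum principle: the set where [w] is maximal is closed under adjacency. *)
Lemma harmonic_constant (R : realFieldType) (n : nat) (e : rel 'I_n)
    (w : 'I_n -> R) :
  connected_graph e ->
  (forall z, \sum_(y | e z y) w y = (deg e z)%:R * w z) ->
  forall x y, w x = w y.
Proof.
move=> econ wh x0 y0; pose m := [arg max_(i > x0) w i]%O.
have mP y : w y <= w m by rewrite /m; case: arg_maxP => // i _; apply.
suff mc y : connect e m y -> w y = w m by rewrite !mc.
case/connectP=> p; elim/last_ind: p y => [|p z IH] y; first by move=> _ ->.
rewrite rcons_path last_rcons => /andP[pp epz ->].
set t := last m p in epz *; have wt : w t = w m by exact: IH.
have : \sum_(y | e t y) (w t - w y) = 0.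
  by rewrite sumrB wh sumr_const mulr_natl /deg cardsE subrr.
move/eqP; rewrite psumr_eq0 => [/allP/(_ z)|i _]; last by rewrite wt subr_ge0.
by rewrite mem_index_enum epz subr_eq0 => /(_ isT) /eqP <-; exact: wt.
Qed.

(** Dividing coordinate [y] of an eigenvector by the square root of its degree turns the eigenvalue
    equation into [A v = (1 - a) D v], where no square root remains. *)
Lemma eigenvalue_norm_lapP (R : rcfType) (n : nat) (e : rel 'I_n) (a : R) :
  symmetric e -> (forall x, (0 < deg e x)%N) ->
  eigenvalue (norm_lap R e) a <->
  exists v : 'I_n -> R, (exists x, v x != 0) /\
    forall z, \sum_(y | e z y) v y = (1 - a) * (deg e z)%:R * v z.
Proof.
move=> esym dpos; pose r x : R := Num.sqrt (deg e x)%:R.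
have r0 x : r x != 0 by rewrite sqrtr_eq0 -ltNge ltr0n.
have rr x : r x * r x = (deg e x)%:R by rewrite -expr2 sqr_sqrtr // ler0n.
have lapE (u : 'rV_n) z : (u *m norm_lap R e) 0 z =
    u 0 z - (\sum_(y | e z y) u 0 y / r y) / r z.
  rewrite mulmxBr mulmx1 mxE; congr (_ + _); rewrite mxE; congr (- _).
  rewrite mulmxA mulmxA /deg_isqrt_mx !mul_mx_diag !mxE; congr (_ / _).
  rewrite [RHS]big_mkcond; apply: eq_bigr => y _; rewrite !mxE esym.
  by case: (e z y); rewrite ?mulr1 ?mulr0.
split.
  case/eigenvalueP => u uM /rV0Pn[x ux].
  exists (fun y => u 0 y / r y); split; first by exists x; rewrite mulf_neq0 ?invr_eq0.
  move=> z; move/rowP/(_ z): uM; rewrite lapE mxE => /eqP.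
  rewrite subr_eq addrC -subr_eq -{1}[u 0 z]mul1r -mulrBl => /eqP uz.
  by rewrite -[LHS](divfK (r0 z)) -uz -rr; field; exact: r0.
case=> v [[x vx] vz]; apply/eigenvalueP; exists (\row_y (v y * r y)).
  apply/rowP => z; rewrite lapE !mxE.
  rewrite (eq_bigr (fun y => v y)) => [|y _]; last by rewrite !mxE mulfK.
  by rewrite vz -rr; field; exact: r0.
by apply/rV0Pn; exists x; rewrite !mxE mulf_neq0.
Qed.

Definition walk_mx (R : fieldType) (n : nat) (e : rel 'I_n) : 'M[R]_n :=
  \matrix_(i, j) ((e i j)%:R / (deg e i)%:R).

(** The matrix [N = 1 - norm_lap] is symmetric and [walk_mx = Si N Si^-1], so a polynomial that
    kills [N] kills the walk matrix. *)
Lemma walk_mx_annihilated (R : rcfType) (n : nat) (e : rel 'I_n.+1)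
    (s : seq R) :
  symmetric e -> (forall x, (0 < deg e x)%N) ->
  (forall a, eigenvalue (norm_lap R e) a -> a \in s) ->
  horner_mx (walk_mx R e) (\prod_(a <- s) ('X - (1 - a)%:P)) = 0.
Proof.
move=> esym dpos sP.
pose Si := deg_isqrt_mx R e; pose N := Si *m adj_mx R e *m Si.
have r0 x : Num.sqrt (deg e x)%:R != 0 :> R by rewrite sqrtr_eq0 -ltNge ltr0n.
have Su : Si \in unitmx.
  rewrite unitmxE det_diag unitfE; apply/prodf_neq0 => i _.
  by rewrite mxE invr_eq0.
have Nsym : N^T = N.
  rewrite /N /Si /deg_isqrt_mx mul_diag_mx mul_mx_diag; apply/matrixP => i j.
  by rewrite !mxE esym; ring.
have Neig t : eigenvalue N t -> t \in [seq 1 - a | a <- s].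
  case/eigenvalueP => u uN u0; apply/mapP; exists (1 - t); last by rewrite subKr.
  apply: sP; apply/eigenvalueP; exists u => //.
  by rewrite mulmxBr mulmx1 -/Si -/N uN scalerBl scale1r.
have := symmetric_mx_annihilated Nsym Neig; rewrite big_map => pN.
have -> : walk_mx R e = Si *m N *m invmx Si.
  rewrite mulmxA mulmxK // mulmxA /Si /deg_isqrt_mx; apply/matrixP => i j.
  rewrite mulmx_diag mul_diag_mx !mxE -invfM -expr2 sqr_sqrtr ?ler0n //.
  by rewrite mulrC.
by rewrite horner_mx_uconj // pN mulmx0 mul0mx.
Qed.

(** As [K] is nonzero, the right side vanishes at no vertex [z] of positive degree; this is what
    bounds distances in the graph. *)
Definition cubic_walk (R : rcfType) (n : nat) (e : rel 'I_n) (a b c K : R) :=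
  let P := walk_mx R e in
  K != 0 /\ forall x z,
    (P *m P *m P) x z + a * (P *m P) x z + b * P x z + c * (x == z)%:R
    = K * (deg e z)%:R.

(** Let [Q] be the value at [P] of the cofactor of [X - 1]. From [P Q = Q] the columns of [Q] are
    harmonic, hence constant; from [Q P = Q] so are its rows after division by the degrees. *)
Lemma walk_mx_cubic (R : rcfType) (n : nat) (e : rel 'I_n) :
  symmetric e -> connected_graph e -> (forall x, (0 < deg e x)%N) ->
  num_distinct_eigenvalues_eq (norm_lap R e) 4 ->
  exists a b c K : R, cubic_walk e a b c K.
Proof.
case: n e => [|n] e esym econ dpos; rewrite /cubic_walk; set P := walk_mx R e.
  by exists 0, 0, 0, 1; split; [exact: oner_neq0 | case].
have d0 x : (deg e x)%:R != 0 :> R by rewrite pnatr_eq0 -lt0n.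
case=> s [us ss sP].
have s0 : 0 \in s.
  apply/sP/eigenvalue_norm_lapP => //; exists (fun=> 1); split.
    by exists ord0; exact: oner_neq0.
  by move=> z; rewrite sum1_deg subr0 mul1r mulr1.
have ps := perm_to_rem s0; rewrite (perm_uniq ps) in us.
move: ss; rewrite (perm_size ps).
have {sP} sP a : eigenvalue (norm_lap R e) a -> a \in 0 :: rem 0 s.
  by move/sP; rewrite (perm_mem ps).
case: (rem 0 s) us sP => [|r1 [|r2 [|r3 []]]] //= us sP _.
have /and3P[r10 r20 r30] : [&& r1 != 0, r2 != 0 & r3 != 0].
  by move: us; rewrite !inE !negb_or ![0 == _]eq_sym -!andbA => /and4P[-> -> ->].
have := walk_mx_annihilated esym dpos sP; rewrite !big_cons big_nil mulr1 subr0.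
set t1 := 1 - r1; set t2 := 1 - r2; set t3 := 1 - r3.
set p := (X in _ * X).
pose a := - (t1 + t2 + t3); pose b := t1 * t2 + t1 * t3 + t2 * t3.
pose c := - (t1 * t2 * t3).
have pE : p = 'X * 'X * 'X + a *: ('X * 'X) + b *: 'X + c%:P.
  rewrite /p /a /b /c; move: (t1) (t2) (t3) => u1 u2 u3.
  rewrite -!mul_polyC !rmorphN !rmorphD !rmorphM /=; ring.
set Q := horner_mx P p.
have QE : Q = P *m P *m P + a *: (P *m P) + b *: P + c%:M.
  by rewrite /Q pE !rmorphD /= !linearZ !rmorphM /= !horner_mx_X horner_mx_C.
have PX : horner_mx P ('X - 1%:P) = P - 1%:M.
  by rewrite rmorphB /= horner_mx_X horner_mx_C.
move=> pP0; have PQ0 : (P - 1%:M) * Q = 0 by rewrite -PX -rmorphM.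
have QP0 : Q * (P - 1%:M) = 0 by rewrite -PX -rmorphM mulrC.
have PQ : P *m Q = Q.
  by apply/eqP; rewrite -subr_eq0 -{2}[Q]mul1mx -mulmxBl; apply/eqP; exact: PQ0.
have QP : Q *m P = Q.
  by apply/eqP; rewrite -subr_eq0 -{2}[Q]mulmx1 -mulmxBr; apply/eqP; exact: QP0.
have Qcol x y z : Q x z = Q y z.
  apply: (harmonic_constant (w := Q^~ z) econ) => {x y} x.
  rewrite -[in RHS]PQ mxE mulr_sumr [LHS]big_mkcond; apply: eq_bigr => y _.
  rewrite mxE; case: (e x y); last by rewrite mul0r mul0r mulr0.
  by rewrite mul1r mulrA mulfV // mul1r.
have Qrow x y z : Q x y / (deg e y)%:R = Q x z / (deg e z)%:R.
  apply: (harmonic_constant (w := fun y => Q x y / (deg e y)%:R) econ) => {y z} y.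
  rewrite mulrC divfK // -[in RHS]QP mxE [LHS]big_mkcond; apply: eq_bigr => z _.
  by rewrite !mxE esym; case: (e z y); rewrite ?mul0r ?mulr0 ?mul1r.
pose K := Q ord0 ord0 / (deg e ord0)%:R.
have QK x z : Q x z = K * (deg e z)%:R.
  by rewrite (Qcol x ord0) /K (Qrow ord0 ord0 z) divfK.
exists a, b, c, K; split; last by move=> x z; rewrite -(QK x z) QE !mxE mulr_natr.
have P1 : P *m const_mx 1 = const_mx 1 :> 'cV_n.+1.
  apply/colP => x; rewrite !mxE -[RHS](mulfV (d0 x)) -(sum1_deg R) mulr_suml.
  rewrite [RHS]big_mkcond; apply: eq_bigr => y _; rewrite !mxE mulr1 sum1_deg.
  by case: (e x y); rewrite ?mul0r.
(* On the constant vector [Q] acts as [1 + a + b + c = (1 - t1)(1 - t2)(1 - t3) = r1 * r2 * r3],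
   which is nonzero; [K = 0] would make [Q] vanish. *)
apply: contra_neq (mulf_neq0 (mulf_neq0 r10 r20) r30) => K0.
have Q0 : Q = 0 by apply/matrixP => x z; rewrite QK K0 mul0r mxE.
have : Q *m const_mx 1 = (1 + a + b + c) *: const_mx 1 :> 'cV_n.+1.
  rewrite QE !mulmxDl -!scalemxAl -!mulmxA !P1 mul_scalar_mx.
  by rewrite !scalerDl scale1r.
rewrite Q0 mul0mx => /colP/(_ ord0); rewrite !mxE mulr1 => ->.
rewrite /a /b /c /t1 /t2 /t3; ring.
Qed.

(** * Counting edges by layers around a vertex *)

Lemma degE (n : nat) (e : rel 'I_n) (x : 'I_n) : deg e x = (\sum_y e x y)%N.
Proof. by rewrite /deg cardsE -sum1_card big_mkcond; apply: eq_bigr => y _. Qed.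

Lemma sum_deg_darts (n : nat) (e : rel 'I_n) :
  (\sum_x deg e x)%N = #|[set p : 'I_n * 'I_n | e p.1 p.2]|.
Proof.
under eq_bigr => x _ do rewrite degE.
rewrite pair_bigA /= -sum1_card [RHS]big_mkcond /=.
by apply: eq_bigr => p _; rewrite inE.
Qed.

(** The degree sum counts ordered adjacent pairs. The fibre of such pairs over an edge has exactly
    two elements, because there are no loops. *)
Lemma handshake (n : nat) (e : rel 'I_n) :
  simple_graph e -> (\sum_x deg e x = 2 * #|edges e|)%N.
Proof.
case=> esym eirr; pose D := [set p : 'I_n * 'I_n | e p.1 p.2].
pose g (p : 'I_n * 'I_n) := [set p.1; p.2].
have -> : edges e = g @: D.
  apply/setP => E; apply/imset2P/imsetP.
    case=> x y _; rewrite inE /= => exy ->.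
    by exists (x, y); rewrite ?inE.
  by case=> -[x y]; rewrite inE => exy ->; exists x y; rewrite ?inE.
rewrite sum_deg_darts -/D -sum1_card (partition_big g (mem (g @: D))) /=; last first.
  by move=> p pD; apply: imset_f.
rewrite mulnC -sum_nat_const; apply: eq_bigr => E /imsetP[[x y]].
rewrite inE /= => exy ->; have xy : x != y.
  by apply: contraTneq exy => ->; rewrite eirr.
rewrite sum1_card (_ : 2 = #|[set (x, y); (y, x)]|)%N; last first.
  by rewrite cards2 xpair_eqE (negbTE xy).
apply: eq_card => -[x' y']; rewrite !inE -!topredE /= !inE /= !xpair_eqE.
apply/idP/idP => [/andP[exy' /eqP gE]|].
  have x'y' : x' != y' by apply: contraTneq exy' => ->; rewrite eirr.
  have: x' \in g (x, y) by rewrite -gE !inE eqxx.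
  have: y' \in g (x, y) by rewrite -gE !inE eqxx orbT.
  rewrite !inE /= => /orP[]/eqP y'E /orP[]/eqP x'E; move: x'y';
    by rewrite x'E y'E ?eqxx ?orbT.
case/orP => /andP[/eqP-> /eqP->]; first by rewrite exy eqxx.
by rewrite esym exy /g /= setUC eqxx.
Qed.

(** Once every such vertex shares a neighbour with [u], these are the vertices at distance exactly
    2. *)
Definition far (n : nat) (e : rel 'I_n) (u z : 'I_n) := (z != u) && ~~ e u z.

Definition common (n : nat) (e : rel 'I_n) (u z : 'I_n) : nat :=
  (\sum_(y | e u y) e z y)%N.

Definition farnbr (n : nat) (e : rel 'I_n) (u z : 'I_n) : nat :=
  (\sum_(y | far e u y) e z y)%N.

Lemma sum_split_nbr (n : nat) (e : rel 'I_n) (u : 'I_n) (F : 'I_n -> nat) :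
  irreflexive e ->
  (\sum_y F y = F u + \sum_(y | e u y) F y + \sum_(y | far e u y) F y)%N.
Proof.
move=> eirr; rewrite (bigD1 u) //= -addnA; congr addn.
rewrite (bigID (e u)) /=; congr addn; apply: eq_bigl => y.
by case: eqP => [->|]; rewrite ?eirr ?andbT ?andbF.
Qed.

Lemma deg_split (n : nat) (e : rel 'I_n) (u z : 'I_n) :
  simple_graph e -> deg e z = (e u z + common e u z + farnbr e u z)%N.
Proof.
case=> esym eirr; rewrite degE (sum_split_nbr u _ eirr) [e z u]esym.
by [].
Qed.

Lemma common_gt0P (n : nat) (e : rel 'I_n) (u z : 'I_n) :
  reflect (exists2 y, e u y & e z y) (0 < common e u z)%N.
Proof.
rewrite lt0n; apply: (iffP idP).
  by rewrite sum_nat_eq0 negb_forall_in => /exists_inP[y euy];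
     rewrite eqb0 negbK; exists y.
by case=> y euy ezy; rewrite /common (bigD1 y) //= ezy.
Qed.

Lemma farnbr_gt0P (n : nat) (e : rel 'I_n) (u z : 'I_n) :
  reflect (exists2 y, far e u y & e z y) (0 < farnbr e u z)%N.
Proof.
rewrite lt0n; apply: (iffP idP).
  by rewrite sum_nat_eq0 negb_forall_in => /exists_inP[y euy];
     rewrite eqb0 negbK; exists y.
by case=> y euy ezy; rewrite /farnbr (bigD1 y) //= ezy.
Qed.

Lemma card_split (n : nat) (e : rel 'I_n) (u : 'I_n) : irreflexive e ->
  n = (1 + deg e u + \sum_(v | far e u v) 1)%N.
Proof.
move=> eirr; rewrite -[LHS]card_ord -sum1_card (sum_split_nbr u _ eirr).
by rewrite degE [X in (_ + X + _)%N = _]big_mkcond.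
Qed.

(* With two concentric layers around [u], the excess of edges over a spanning
   tree is carried by edges inside a layer and by double edges between layers. *)
Lemma excess_count (n : nat) (e : rel 'I_n) (u : 'I_n) :
  simple_graph e -> (\sum_x deg e x = 2 * n)%N ->
  (\sum_(v | e u v) common e u v +
   \sum_(v | far e u v) (2 * common e u v + farnbr e u v)
   = 2 + 2 * \sum_(v | far e u v) 1)%N.
Proof.
move=> es; have [esym eirr] := es.
have n1 := card_split u eirr.
have split1 : (\sum_(v | e u v) deg e v = deg e u + \sum_(v | e u v) common e u v
   + \sum_(v | e u v) farnbr e u v)%N.
  rewrite degE (_ : \sum_y _ = \sum_(v | e u v) 1)%N; last first.
    by rewrite [RHS]big_mkcond.
  rewrite -!big_split /=; apply: eq_bigr => v euv.
  by rewrite (deg_split u) // euv.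
have split2 : (\sum_(v | far e u v) deg e v = \sum_(v | far e u v) common e u v
   + \sum_(v | far e u v) farnbr e u v)%N.
  rewrite -big_split /=; apply: eq_bigr => v /andP[_ /negbTE euv].
  by rewrite (deg_split u) // euv.
have exch : (\sum_(v | e u v) farnbr e u v = \sum_(v | far e u v) common e u v)%N.
  rewrite exchange_big /=; apply: eq_bigr => v _; apply: eq_bigr => y _.
  by rewrite esym.
rewrite (sum_split_nbr u _ eirr) split1 split2 exch [in RHS]n1.
rewrite [in X in _ -> X]big_split /= -big_distrr /=.
set A := (\sum_(v | e u v) _)%N; set B := (\sum_(v | far e u v) common _ _ _)%N.
set C := (\sum_(v | far e u v) farnbr _ _ _)%N; lia.
Qed.

(** * Pendant vertices and the entries of the cubic identity *)

Definition leaf_at (n : nat) (e : rel 'I_n) (x u : 'I_n) :=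
  forall y, e x y = (y == u).

Lemma deg_leaf_at (n : nat) (e : rel 'I_n) (x u : 'I_n) :
  leaf_at e x u -> deg e x = 1%N.
Proof.
by move=> xu; rewrite /deg -(cards1 u); apply: eq_card => y; rewrite !inE xu.
Qed.

Lemma leaf_atP (n : nat) (e : rel 'I_n) (x u : 'I_n) :
  deg e x = 1%N -> e x u -> leaf_at e x u.
Proof.
move/eqP/cards1P => [v ev] exu y.
by have := in_set1 y v; rewrite -ev inE => ->; have := in_set1 u v;
   rewrite -ev inE exu => /esym/eqP ->.
Qed.

(** For symmetric [e] this is [deg e u] times the entry [(u, z)] of the squared walk matrix. *)
Definition tsum (R : rcfType) (n : nat) (e : rel 'I_n) (u z : 'I_n) : R :=
  \sum_(y | e u y && e z y) ((deg e y)%:R)^-1.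

Lemma tsumE (R : rcfType) (n : nat) (e : rel 'I_n) (u z : 'I_n) (t : R) :
  (forall y, e u y -> e z y -> ((deg e y)%:R)^-1 = t) ->
  tsum R e u z = (common e u z)%:R * t.
Proof.
move=> H; rewrite /tsum (eq_bigr (fun=> t)) => [|y /andP[]]; last exact: H.
rewrite big_mkcondr /common natr_sum mulr_suml; apply: eq_bigr => y _.
by case: (e z y); rewrite ?mul1r ?mul0r.
Qed.

Lemma common1_uniq (n : nat) (e : rel 'I_n) (u z y y' : 'I_n) :
  common e u z = 1%N -> e u y -> e z y -> e u y' -> e z y' -> y' = y.
Proof.
move=> c1 uy zy uy' zy'; apply/eqP/negPn/negP => ny.
by move: c1; rewrite /common (bigD1 y) //= (bigD1 y') /= ?uy' // zy zy'.
Qed.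

Lemma tsum1 (R : rcfType) (n : nat) (e : rel 'I_n) (u z y : 'I_n) :
  common e u z = 1%N -> e u y -> e z y -> tsum R e u z = ((deg e y)%:R)^-1.
Proof.
move=> c1 uy zy; rewrite (tsumE (t := ((deg e y)%:R)^-1)) ?c1 ?mul1r // => y' uy' zy'.
by rewrite (common1_uniq c1 uy zy uy' zy').
Qed.

Lemma tsum0 (R : rcfType) (n : nat) (e : rel 'I_n) (u z : 'I_n) :
  common e u z = 0%N -> tsum R e u z = 0.
Proof.
move=> c0; rewrite /tsum big_pred0 // => y; apply/negP => /andP[uy zy].
by move: c0; rewrite /common (bigD1 y) //= zy.
Qed.

(** Row [x] of the walk matrix is the unit vector at [u], so row [x] of each power is row [u] of the
    previous one. This is row [x] of the cubic identity multiplied by [deg e u]. *)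
Lemma leaf_equation (R : rcfType) (n : nat) (e : rel 'I_n) (a b c K : R)
    (x u z : 'I_n) :
  simple_graph e -> (forall x, (0 < deg e x)%N) ->
  cubic_walk e a b c K -> leaf_at e x u ->
  let D : R := (deg e u)%:R in
  tsum R e u z + a * (e u z)%:R + b * D * (z == u)%:R + c * D * (z == x)%:R
  = K * D * (deg e z)%:R.
Proof.
move=> [esym eirr] dpos [_ cub] xu D; have dx := deg_leaf_at xu.
have D0 : D != 0 by rewrite pnatr_eq0 -lt0n.
have Px y : walk_mx R e x y = (y == u)%:R by rewrite mxE xu dx divr1.
have P2 y : (walk_mx R e *m walk_mx R e) x y = walk_mx R e u y.
  rewrite mxE (bigD1 u) //= Px eqxx mul1r big1 ?addr0 // => w wu.
  by rewrite Px (negbTE wu) mul0r.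
have P3 : (walk_mx R e *m walk_mx R e *m walk_mx R e) x z = D^-1 * tsum R e u z.
  rewrite mxE mulr_sumr [RHS]big_mkcond; apply: eq_bigr => y _.
  rewrite P2 !mxE [e y z]esym; case: (e u y); case: (e z y);
    by rewrite ?mul0r ?mulr0 ?mul1r.
have := cub x z; rewrite P3 P2 Px mxE -/D [x == z]eq_sym => H.
by rewrite [RHS]mulrAC -H; field.
Qed.

Lemma deg2_nbrs (n : nat) (e : rel 'I_n) (v p q : 'I_n) :
  deg e v = 2%N -> e v p -> e v q -> p != q ->
  forall y, e v y = (y == p) || (y == q).
Proof.
move=> d2 vp vq pq y; have /eqP E : [set p; q] == [set y | e v y].
  rewrite eqEcard -/(deg e v) d2 cards2 pq andbT.
  by apply/subsetP => w; rewrite !inE => /orP[]/eqP->.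
by have := in_set2 y p q; rewrite E inE.
Qed.

(** This is twice the diagonal entry at [v] of the cubic identity. The linear term drops out as
    there are no loops, and the cubic term sees only a triangle [v p q]. *)
Lemma deg2_equation (R : rcfType) (n : nat) (e : rel 'I_n) (a b c K : R)
    (v p q : 'I_n) :
  simple_graph e -> cubic_walk e a b c K ->
  deg e v = 2%N -> e v p -> e v q -> p != q ->
  let dp : R := (deg e p)%:R in let dq : R := (deg e q)%:R in
  2 * (e p q)%:R * (dp^-1 * dq^-1) + a * (dp^-1 + dq^-1) + 2 * c = 4 * K.
Proof.
move=> [esym eirr] [_ cub] d2 vp vq pq dp dq; have vN := deg2_nbrs d2 vp vq pq.
set P := walk_mx R e in cub.
have sumv (F : 'I_n -> R) : (forall y, ~~ e v y -> F y = 0) ->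
    \sum_y F y = F p + F q.
  move=> F0; rewrite (bigD1 p) //= (bigD1 q) /=; last by rewrite eq_sym.
  rewrite big1 ?addr0 // => y /andP[yp yq]; apply: F0.
  by rewrite vN (negbTE yp) (negbTE yq).
have Pv y : P v y = (e v y)%:R / 2 by rewrite mxE d2.
have P2 w : (P *m P) v w = (P p w + P q w) / 2.
  rewrite mxE sumv => [|y /negbTE vy]; last by rewrite Pv vy !mul0r.
  by rewrite !Pv vp vq !mulr1n; field.
have := cub v v; rewrite mxE sumv => [|y /negbTE vy]; last first.
  by rewrite [P y v]mxE esym vy mul0r mulr0.
rewrite !P2 !mxE eqxx d2 !eirr [e q p]esym [e p v]esym [e q v]esym vp vq !mulr1n.
rewrite !mulr0n -/dp -/dq; move: (dp^-1) (dq^-1) => x y E.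
have -> : 4 * K = 2 * (K * 2) by ring.
by rewrite -E; field.
Qed.

Lemma nbr_notin (n : nat) (e : rel 'I_n) (y : 'I_n) (s : seq 'I_n) :
  (size s < deg e y)%N -> exists2 w, e y w & w \notin s.
Proof.
move=> ds; case: (pickP [pred w | e y w && (w \notin s)]) => [w /andP[]|sub].
  by exists w.
suff : (deg e y <= size s)%N by rewrite leqNgt ds.
apply: leq_trans (card_size s); apply/subset_leq_card/subsetP => w.
by rewrite inE => yw; have := sub w; rewrite /= yw => /negbFE.
Qed.

Lemma sum_nat_tight (I : finType) (P : pred I) (F : I -> nat) (k : nat) :
  (forall i, P i -> (k <= F i)%N) ->
  (\sum_(i | P i) F i <= k * \sum_(i | P i) 1)%N -> forall i, P i -> F i = k.
Proof.
move=> kF; rewrite big_distrr /= => le i Pi; apply/eqP.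
rewrite eqn_leq kF // andbT leqNgt; apply/negP => lt; move: le.
rewrite (bigD1 i) //= [leqRHS](bigD1 i) //= leqNgt => /negP; apply.
rewrite muln1 -addSn leq_add //; apply: leq_sum => j /andP[Pj _].
by rewrite ?muln1 kF.
Qed.

Lemma common_gt1 (n : nat) (e : rel 'I_n) (u z y : 'I_n) :
  (1 < common e u z)%N -> e u y -> e z y ->
  exists y', [/\ y' != y, e u y' & e z y'].
Proof.
move=> c1 uy zy; case: (pickP [pred w | [&& w != y, e u w & e z w]]).
  by move=> w /and3P[]; exists w.
move=> no; move: c1; rewrite /common (bigD1 y) //= zy big1 // => w /andP[uw wy].
by have := no w; rewrite /= wy uw /= => ->.
Qed.

Lemma nbrs_seq (n : nat) (e : rel 'I_n) (v : 'I_n) (s : seq 'I_n) :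
  uniq s -> {subset s <= e v} -> (deg e v <= size s)%N -> forall y, e v y -> y \in s.
Proof.
move=> us sN ds y; have sub : [set x in s] \subset [set x | e v x].
  by apply/subsetP => x; rewrite !inE; exact: sN.
have /eqP E : [set x in s] == [set x | e v x].
  by rewrite eqEcard sub -/(deg e v) cardsE (card_uniqP us) ds.
by have := in_set (mem s) y; rewrite E inE => ->.
Qed.

Lemma leq_size_deg (n : nat) (e : rel 'I_n) (v : 'I_n) (s : seq 'I_n) :
  uniq s -> {subset s <= e v} -> (size s <= deg e v)%N.
Proof.
move=> us sN; rewrite -(card_uniqP us) -cardsE subset_leq_card //.
by apply/subsetP => x; rewrite !inE; exact: sN.
Qed.

(* Equality of the edge counts forces an edge-preserving bijection to reflect
   edges as well. *)
Lemma graph_iso_seq (n m : nat) (e : rel 'I_n) (e' : rel 'I_m) (s : seq 'I_n) :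
  uniq s -> size s = m -> (forall x, x \in s) ->
  (forall x0 (i j : 'I_m), e' i j -> e (nth x0 s i) (nth x0 s j)) ->
  (\sum_x deg e x <= \sum_i deg e' i)%N -> graph_iso e e'.
Proof.
move=> us ss sall pres cnt.
have fP x : (index x s < m)%N by rewrite -ss index_mem.
pose f x := Ordinal (fP x).
have finj : injective f.
  by move=> x y /(congr1 val) /= E; rewrite -(nth_index x (sall x)) E nth_index.
have fbij : bijective f.
  apply: inj_card_bij => //; rewrite !card_ord -ss -(card_uniqP us).
  by rewrite -[leqRHS]card_ord max_card.
exists f; split=> // x y; have [g fK gK] := fbij.
pose D := [set p : 'I_n * 'I_n | e p.1 p.2].
pose D' := [set p : 'I_m * 'I_m | e' p.1 p.2].
pose h (p : 'I_m * 'I_m) := (g p.1, g p.2).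
have hinj : injective h.
  by move=> [i j] [i' j'] [/(can_inj gK) -> /(can_inj gK) ->].
have gE i x0 : g i = nth x0 s i by rewrite -[in RHS](gK i) /= nth_index.
have sub : h @: D' \subset D.
  apply/subsetP => _ /imsetP[[i j] + ->]; rewrite !inE /= => /pres.
  by move/(_ x); rewrite -!gE.
have /eqP E : h @: D' == D.
  by rewrite eqEcard sub card_imset // -!sum_deg_darts.
have := in_set (fun p : 'I_n * 'I_n => e p.1 p.2) (x, y); rewrite -/D /= => <-.
rewrite -E -[(x, y)]/(x, y) -{2}(fK x) -{2}(fK y) -[(g _, g _)]/(h (f x, f y)).
by rewrite mem_imset // inE.
Qed.

Lemma sum_deg_U2_1 : (\sum_i deg U2_1 i = 8)%N.
Proof. by under eq_bigr => i _ do rewrite degE; rewrite !big_ord_recl !big_ord0. Qed.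

Lemma sum_deg_U4_111 : (\sum_i deg U4_111 i = 12)%N.
Proof. by under eq_bigr => i _ do rewrite degE; rewrite !big_ord_recl !big_ord0. Qed.

(** * Graphs with a pendant vertex *)

Section LeafAnalysis.

Context (R : rcfType) (n : nat) (e : rel 'I_n) (a b c K : R).
Hypothesis es : simple_graph e.
Hypothesis dpos : forall x, (0 < deg e x)%N.
Hypothesis dsum : (\sum_x deg e x = 2 * n)%N.
Hypothesis cub : cubic_walk e a b c K.

Local Notation d y := ((deg e y)%:R : R).

Lemma deg_neq0 y : d y != 0.
Proof. by rewrite pnatr_eq0 -lt0n. Qed.

Lemma coef_neq0 u : K * d u != 0.
Proof. by rewrite mulf_neq0 ?deg_neq0 //; case: cub. Qed.

(** The case [z = x] of the leaf equation: the only neighbour of [x] is [u], which is not its own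
    neighbour, so the two-step term is zero. *)
Lemma leaf_diag x u : leaf_at e x u -> a + c * d u = K * d u.
Proof.
move=> xu; have [esym eirr] := es.
have eux : e u x by rewrite esym xu.
have xNu : x != u by apply: contraTneq eux => ->; rewrite eirr.
have := leaf_equation x es dpos cub xu; rewrite /= eux eqxx (negbTE xNu).
rewrite tsum0; first by rewrite (deg_leaf_at xu) => E; rewrite -[RHS]mulr1 -E !mulr1n mulr0n; ring.
by rewrite /common big1 // => y; rewrite xu; case: eqP => // ->; rewrite eirr.
Qed.

Lemma leaf_near x u z : leaf_at e x u -> e u z -> z != x ->
  tsum R e u z + a = K * d u * d z.
Proof.
move=> xu uz zx; have [esym eirr] := es.
have zNu : z != u by apply: contraTneq uz => ->; rewrite eirr.
have := leaf_equation z es dpos cub xu; rewrite /= uz (negbTE zx) (negbTE zNu).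
by rewrite !mulr0 !addr0 mulr1.
Qed.

Lemma leaf_far x u z : leaf_at e x u -> far e u z ->
  tsum R e u z = K * d u * d z.
Proof.
move=> xu /andP[zu uz]; have [esym eirr] := es.
have zNx : z != x by apply: contraNneq uz => ->; rewrite esym xu.
have := leaf_equation z es dpos cub xu; rewrite /= (negbTE uz) (negbTE zNx).
by rewrite (negbTE zu) !mulr0 !addr0.
Qed.

(** By [leaf_far] the two-step term equals the nonzero [K * d u * d z]. Hence the graph has radius
    at most 2 around the neighbour of a leaf. *)
Lemma far_common x u z : leaf_at e x u -> far e u z -> (0 < common e u z)%N.
Proof.
move=> xu zf; rewrite lt0n; apply/eqP => c0.
have := leaf_far xu zf; rewrite tsum0 // => /esym/eqP.
by rewrite mulf_eq0 (negbTE (coef_neq0 _)) (negbTE (deg_neq0 _)).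
Qed.

(** [leaf_diag] reads [a = (K - c) * d u]; with [a != 0] this determines the degree. *)
Lemma leaf_support_deg x u x' u' : a != 0 ->
  leaf_at e x u -> leaf_at e x' u' -> deg e u = deg e u'.
Proof.
move=> a0 /leaf_diag E /leaf_diag E'; apply/eqP; rewrite -(eqr_nat R).
have H y : a + c * d y = K * d y -> a = (K - c) * d y by move=> h; rewrite mulrBl -h; ring.
have Kc : K - c != 0 by apply: contra_neq a0 => k0; rewrite (H _ E) k0 mul0r.
by rewrite -(inj_eq (mulfI Kc)) -(H _ E) -(H _ E').
Qed.

Lemma far_deg u z : far e u z -> deg e z = (common e u z + farnbr e u z)%N.
Proof. by case/andP=> _ /negbTE uz; rewrite (deg_split u _ es) uz. Qed.

(** All neighbours of [u] other than [x] satisfy [a = K * d u * d y], so they share one degree [dl].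
    By [excess_count] either two far vertices are adjacent or some far vertex has two common
    neighbours with [u]; both are refuted. *)
Lemma no_triangle_at_support x u : leaf_at e x u ->
  (forall y, e u y -> common e u y = 0%N) -> False.
Proof.
move=> xu tri0; have [esym eirr] := es.
have cnt := excess_count u es dsum; rewrite big1 ?add0n in cnt => //.
have /= fcom z := far_common (z := z) xu.
have eux : e u x by rewrite esym xu.
have farNx z y : far e u z -> e z y -> y != x.
  by move=> /andP[zu _]; apply: contraTneq => ->; rewrite esym xu.
have farN y z : e u y -> e y z -> z != u -> far e u z.
  move=> uy yz zu; rewrite /far zu; apply/negP => uz.
  by have /eqP := tri0 y uy; rewrite -leqn0 leqNgt => /negP; apply; apply/common_gt0P; exists z.
have aE y : e u y -> y != x -> a = K * d u * d y.
  by move=> uy yx; rewrite -(leaf_near xu uy yx) tsum0 ?add0r ?tri0.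
have [z0 z0f|nofar] := pickP (far e u); last first.
  by move: cnt; rewrite !big_pred0.
have /common_gt0P[y0 uy0 zy0] := fcom z0 z0f.
have y0x := farNx _ _ z0f zy0.
pose dl := deg e y0.
have dlE y : e u y -> y != x -> deg e y = dl.
  move=> uy yx; apply/eqP; rewrite -(eqr_nat R).
  by rewrite -(inj_eq (mulfI (coef_neq0 u))) -!aE.
have dl2 : (2 <= dl)%N.
  rewrite /dl (deg_split u _ es) uy0 tri0 // addn0 add1n ltnS.
  by apply/farnbr_gt0P; exists z0 => //; rewrite esym.
have aK := aE y0 uy0 y0x; rewrite -/dl in aK.
have a0 : a != 0 by rewrite aK mulf_neq0 ?coef_neq0 // pnatr_eq0 -lt0n; exact: ltnW.
have dl0 : (dl%:R : R) != 0 by rewrite pnatr_eq0 -lt0n; exact: ltnW.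
(* For each far [z], the coefficient [a] is the proportion of its neighbours that are adjacent to
   [u]. *)
have Ez z : far e u z -> (common e u z)%:R = a * (common e u z + farnbr e u z)%:R.
  move=> zf; have := leaf_far xu zf; rewrite (tsumE (t := dl%:R^-1)) => [E|y uy zy].
    by rewrite -far_deg // aK mulrAC -E divfK.
  by rewrite dlE // (farNx _ _ zf zy).
have Dx := leaf_diag xu.
have D2 : (2 <= deg e u)%N.
  rewrite (leq_trans _ (subset_leq_card (A := [set x; y0]) _)) //.
    by rewrite cards2 eq_sym y0x.
  by apply/subsetP => w; rewrite !inE => /orP[]/eqP->.
(* First case: an edge [z1 z2] joins two far vertices. *)
have [z1 /andP[z1f /farnbr_gt0P[z2 z2f z12]]|nob] :=
  pickP [pred z | far e u z && (0 < farnbr e u z)%N].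
  have z21 : z2 != z1 by apply: contraTneq z12 => ->; rewrite eirr.
  have b1 : (0 < farnbr e u z1)%N by apply/farnbr_gt0P; exists z2.
  have b2 : (0 < farnbr e u z2)%N by apply/farnbr_gt0P; exists z1; rewrite // esym.
  have c1 := fcom _ z1f; have c2 := fcom _ z2f.
  have fz2 : far e u z2 && (z2 != z1) by rewrite z2f.
  move: cnt; rewrite (bigD1 z1) //= (bigD1 z2) //=.
  rewrite [in X in _ = X](bigD1 z1) //= [in X in _ = X](bigD1 z2) //=.
  set A := (\sum_(i | _) _)%N; set B := (\sum_(i | _) 1)%N => cnt.
  have AB2 : (2 * B <= A)%N.
    rewrite /B big_distrr leq_sum //= => z /andP[/andP[zf _] _].
    by move: (fcom _ zf); clear; lia.
  (* The count reads [(2 c1 + b1) + (2 c2 + b2) + A = 6 + 2 B], while each bracket is at least 3 and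
     [A] is at least [2 B]; all bounds are attained. *)
  have [c11 b11] : common e u z1 = 1%N /\ farnbr e u z1 = 1%N by move: cnt AB2 c1 c2 b1 b2; clear; lia.
  have ah : a = 2^-1.
    have := Ez _ z1f; rewrite c11 b11 => /= E.
    by apply: (mulIf (x := 2)); rewrite ?pnatr_eq0 // -E mulVf ?pnatr_eq0.
  (* With [a = 1/2] every far vertex has as many far neighbours as common ones, so it weighs at
     least 3 and no far vertex besides [z1], [z2] remains. *)
  have AB3 : (3 * B <= A)%N.
    rewrite /B big_distrr leq_sum //= => z /andP[/andP[zf _] _].
    suff <- : common e u z = farnbr e u z.
      by move: (fcom _ zf); clear; lia.
    have := Ez _ zf; rewrite ah natrD => E; apply/eqP; rewrite -(eqr_nat R); apply/eqP.
    lra.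
  have B0 : B = 0%N by move: cnt AB2 AB3 c1 c2 b1 b2; clear; lia.
  have f12 z : far e u z -> z = z1 \/ z = z2.
    move=> zf; case: (eqVneq z z1) => [->|zz1]; first by left.
    case: (eqVneq z z2) => [->|zz2]; first by right.
    by move: B0; rewrite /B (bigD1 z) //= zf zz1 zz2.
  have n1 := card_split u eirr.
  have mE : (\sum_(v | far e u v) 1 = 2)%N.
    by rewrite (bigD1 z1) //= (bigD1 z2) //= -/B B0.
  have dz1 : deg e z1 = 2%N by rewrite (far_deg z1f) c11 b11.
  have dz2 : deg e z2 = 2%N by rewrite (far_deg z2f); move: cnt AB2 c1 c2 b1 b2; clear; lia.
  have SN : (\sum_(y | e u y) deg e y = 1 + (deg e u - 1) * dl)%N.
    rewrite (bigD1 x) //= (deg_leaf_at xu); congr addn.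
    rewrite (eq_bigr (fun=> dl)) => [|y /andP[]]; last exact: dlE.
    rewrite sum_nat_const; congr muln; rewrite /deg (cardsD1 x) inE eux add1n subn1 /=.
    by apply: eq_card => y; rewrite !inE -topredE /= andbC.
  have SF : (\sum_(y | far e u y) deg e y = 4)%N.
    rewrite (bigD1 z1) //= (bigD1 z2) //= dz1 dz2 big1 // => z /andP[/andP[zf]].
    by case: (f12 _ zf) => ->; rewrite eqxx.
  have /common_gt0P[y1 uy1 zy1] := c1.
  have dy1 := dlE _ uy1 (farNx _ _ z1f zy1).
  have := dsum; rewrite (sum_split_nbr u _ eirr) SN SF => ds.
  (* The degree sum gives [(D - 1) * dl = D + 1] for [D = deg e u], with only these solutions in the
     given range. *)
  have [[Du dlv]|[Du dlv]] : (deg e u = 2 /\ dl = 3) \/ (deg e u = 3 /\ dl = 2).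
    move: n1 ds D2 dl2; rewrite mE; clear.
    case: (deg e u) dl => [|[|D]] [|[|dl]] //= n1 ds _ _.
    rewrite subn1 /= in ds; have {n1 ds} : (D.+1 * dl + D = 1)%N by lia.
    by case: D => [|[|D]]; case: dl => [|[|dl]]; rewrite ?mulnS; lia.
  (* The diagonal entry at [z1] fails whether or not [z2] and [y1] are adjacent. *)
  - have z2y1 : z2 != y1 by apply: contraTneq uy1 => <-; case/andP: z2f.
    have := deg2_equation es cub dz1 z12 zy1 z2y1.
    rewrite dz2 dy1 dlv /= => E; move: Dx aK E; rewrite Du dlv ah.
    by case: (e z2 y1); rewrite ?mulr1n ?mulr0n; lra.
  (* Here [y1] has degree 2, and its diagonal entry fails. *)
  have uz1 : u != z1 by rewrite eq_sym; case/andP: z1f.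
  have y1u : e y1 u by rewrite esym.
  have y1z1 : e y1 z1 by rewrite esym.
  have := deg2_equation es cub (etrans dy1 dlv) y1u y1z1 uz1.
  have /andP[_ /negbTE ->] := z1f.
  rewrite dz1 /= => E; move: Dx aK E; rewrite Du dlv ah mulr0n; lra.
have {nob} b0 z : far e u z -> farnbr e u z = 0%N.
  by move=> zf; have := nob z; rewrite /= zf /= lt0n => /negbFE/eqP.
have a1 : a = 1.
  have := Ez _ z0f; rewrite (b0 _ z0f) addn0 => E; apply: (mulIf (x := (common e u z0)%:R)).
    by rewrite pnatr_eq0 -lt0n fcom.
  by rewrite -E mul1r.
(* Second case: the far vertices are pairwise nonadjacent, so the excess needs a far [v] with
   several common neighbours. *)
have [v /andP[vf cv]|noc] := pickP [pred z | far e u z && (1 < common e u z)%N]; last first.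
  move: cnt; rewrite big_distrr /= (eq_bigr (fun=> 2 * 1)%N); first by clear; lia.
  move=> z zf; have := noc z; rewrite /= zf /= => /negbT; have := fcom _ zf.
  by rewrite b0 //; clear; lia.
move: cnt; rewrite (bigD1 v) //= [in X in _ = X](bigD1 v) //=.
set A := (\sum_(i | _) _)%N; set B := (\sum_(i | _) 1)%N => cnt.
(* [v] absorbs the whole excess, so every other far vertex turns out to be a leaf. *)
have tight z : far e u z -> z != v -> common e u z = 1%N.
  move=> zf zv; have : (2 * common e u z + farnbr e u z = 2)%N.
    apply: (@sum_nat_tight _ [pred z | far e u z && (z != v)]
       (fun z => 2 * common e u z + farnbr e u z)%N); rewrite /= ?zf //.
      by move=> w /andP[wf _]; move: (fcom _ wf); clear; lia.
    by change (A <= 2 * B)%N; move: cnt cv; clear; lia.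
  by move: (b0 _ zf); clear; lia.
have AB : (2 * B <= A)%N.
  by rewrite /B big_distrr leq_sum //= => z /andP[zf _]; move: (fcom _ zf); clear; lia.
have cv2 : common e u v = 2%N by move: cnt AB cv (b0 _ vf); clear; lia.
have dv : deg e v = 2%N by rewrite (far_deg vf) cv2 b0.
have /common_gt0P[y1 uy1 vy1] := fcom _ vf.
have [y2 [y21 uy2 vy2]] := common_gt1 cv uy1 vy1.
have y1x := farNx _ _ vf vy1; have y2x := farNx _ _ vf vy2.
have farleaf y z : e u y -> e y z -> z != u -> z != v -> leaf_at e z y.
  move=> uy yz zu zv; have zf := farN _ _ uy yz zu.
  by apply: leaf_atP; rewrite 1?esym // (far_deg zf) tight // b0.
(* If [dl] is at least 3, both [y1] and [y2] carry leaves [z1], [z2]. As [z1] is a leaf at [y1], the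
   vertex [z2] must be within distance 2 of [y1], which makes [y1] and [y2] adjacent and closes a
   triangle at [u]. *)
have [dl3|dle2] := ltnP 2 dl.
  have third y : e u y -> y != x -> exists z, [/\ e y z, z != u & z != v].
    move=> uy yx; have [|z yz] := @nbr_notin _ e y [:: u; v]; first by rewrite dlE.
    by rewrite !inE negb_or => /andP[]; exists z.
  have [z1 [yz1 z1u z1v]] := third _ uy1 y1x.
  have [z2 [yz2 z2u z2v]] := third _ uy2 y2x.
  have l1 := farleaf _ _ uy1 yz1 z1u z1v; have l2 := farleaf _ _ uy2 yz2 z2u z2v.
  have z2f : far e y1 z2.
    rewrite /far esym l2 [y1 == _]eq_sym y21 andbT.
    apply: contraTneq uy1 => <-.
    by have /andP[] := farN _ _ uy2 yz2 z2u.
  have /common_gt0P[y y1y] := far_common l1 z2f.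
  rewrite l2 => /eqP yy2; rewrite {}yy2 in y1y.
  have y2u : y2 != u by apply: contraTneq uy2 => ->; rewrite eirr.
  by have := farN _ _ uy1 y1y y2u; rewrite /far uy2 andbF.
have dlv : dl = 2%N by apply/eqP; rewrite eqn_leq dle2 dl2.
have uv : u != v by rewrite eq_sym; case/andP: vf.
have dy1 : deg e y1 = 2%N by rewrite dlE.
have y1u : e y1 u by rewrite esym.
have y1v : e y1 v by rewrite esym.
have := deg2_equation es cub dy1 y1u y1v uv.
have /andP[_ /negbTE ->] := vf; rewrite dv mulr0n /= => E.
(* Multiplied by [D], the diagonal entry at [y1] becomes [D / 2 = 2], using [K * D = 1/2] and
   [c * D = - 1/2]. *)
have D4 : deg e u = 4%N.
  apply/eqP; rewrite -(eqr_nat R); apply/eqP; move: Dx aK E (deg_neq0 u).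
  rewrite a1 dlv; set D := d u => Dx aK E D0.
  have : D * (2 * 0 * (D^-1 / 2) + 1 * (D^-1 + 2^-1) + 2 * c) = 4 * (K * D).
    by rewrite E; ring.
  rewrite !mulr0 mul0r add0r mul1r !mulrDr mulfV //.
  lra.
(* A fourth neighbour [y3] of [u] is not joined to [v], so it supports a leaf; but its degree is 2
   and that of [u] is 4, against [leaf_support_deg]. *)
have [|y3 uy3] := @nbr_notin _ e u [:: x; y1; y2]; first by rewrite D4.
rewrite !inE !negb_or => /and3P[y3x y31 y32].
have [|z yz] := @nbr_notin _ e y3 [:: u]; first by rewrite dlE // dlv.
rewrite inE => zu.
have zv : z != v.
  apply: contra_eq_neq cv2 => zv; rewrite zv in yz.
  rewrite /common (bigD1 y1) //= (bigD1 y2) /= ?uy2 // (bigD1 y3) /= ?uy3 ?y31 //.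
  by rewrite vy1 vy2 [e v y3]esym yz.
have := leaf_support_deg a0 xu (farleaf _ _ uy3 yz zu zv).
by rewrite D4 dlE // dlv.
Qed.

(** The second leaf [z] gives [K * d u * d y1 = 1], hence [a != 0]. All three triangle vertices then
    have equal degree 3, and the third neighbour of [y2] is a leaf as well. *)
Lemma pendant_triangle x u y1 y2 z : leaf_at e x u ->
  e u y1 -> e u y2 -> e y1 y2 ->
  (forall w, e u w -> w \in [:: x; y1; y2]) ->
  (forall v, far e u v -> exists2 y, e u y & leaf_at e v y) ->
  (d y2)^-1 + a = K * d u * d y1 -> (d y1)^-1 + a = K * d u * d y2 ->
  far e u z -> leaf_at e z y1 -> graph_iso e U4_111.
Proof.
move=> xu uy1 uy2 y12 Nu farP E1 E2 zf zy1; have [esym eirr] := es.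
have neq v w : e v w -> v != w by move=> vw; apply: contraTneq vw => ->; rewrite eirr.
have ux : e u x by rewrite esym xu.
have notx y w : e u y -> e y w -> w != x.
  by move=> uy; apply: contraTneq => ->; rewrite esym xu eq_sym (negbTE (neq _ _ uy)).
have y1x : y1 != x by apply: notx uy2 _; rewrite esym.
have y2x : y2 != x by apply: notx uy1 _.
have y12n := neq _ _ y12.
have uN : uniq [:: x; y1; y2] by rewrite /= !inE !negb_or ![x == _]eq_sym y1x y2x y12n.
have Du : deg e u = 3%N.
  rewrite -[RHS](card_uniqP uN); apply: eq_card => w; rewrite !inE.
  apply/idP/idP => [/Nu|]; first by rewrite !inE.
  by case/or3P => /eqP->.
have KE : K * d u * d y1 = 1.
  have := leaf_far xu zf; rewrite (deg_leaf_at zy1) mulr1 => <-.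
  rewrite (tsum1 _ _ uy1) ?zy1 ?mulVf ?deg_neq0 //.
  have := far_common xu zf; have := far_deg zf; rewrite (deg_leaf_at zy1).
  by clear; lia.
have d2 : (2 <= deg e y2)%N.
  apply: (@leq_size_deg _ e y2 [:: u; y1]).
    by rewrite /= inE (neq _ _ uy1).
  by move=> w; rewrite !inE => /orP[]/eqP->; rewrite -topredE /= esym.
have a0 : a != 0.
  apply: contraTneq d2 => a0; move: E1; rewrite KE a0 addr0 => /eqP.
  rewrite invr_eq1 pnatr_eq1 => /eqP ->.
  by [].
have d12 : deg e y1 = deg e y2.
  apply/eqP; rewrite -(eqr_nat R) -(inj_eq (mulfI a0)); apply/eqP.
  (* [E2] times [d y1] and [E1] times [d y2] have the same right side. *)
  have : d y1 * (d y1)^-1 + d y1 * a = d y2 * (d y2)^-1 + d y2 * a.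
    by rewrite -!mulrDr E1 E2; ring.
  by rewrite !mulfV ?deg_neq0 // => /addrI; rewrite mulrC => ->; rewrite mulrC.
have dy1 : deg e y1 = 3%N by rewrite -Du (leaf_support_deg a0 xu zy1).
have dy2 : deg e y2 = 3%N by rewrite -d12.
have [|z2 yz2] := @nbr_notin _ e y2 [:: u; y1]; first by rewrite dy2.
rewrite !inE negb_or => /andP[z2u z2y1].
have z2f : far e u z2.
  rewrite /far z2u; apply/negP => /Nu; rewrite !inE => /or3P[]/eqP z2E.
  - by have := notx _ _ uy2 yz2; rewrite z2E eqxx.
  - by rewrite z2E eqxx in z2y1.
  - by rewrite z2E eirr in yz2.
have z2y2 : leaf_at e z2 y2.
  have [y uy l] := farP _ z2f; have /eqP E : y2 == y by rewrite -l esym.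
  by rewrite E.
have farN v w : far e u v -> e u w -> v != w.
  by move=> /andP[_ uv] uw; apply: contraNneq uv => ->.
have zu : z != u by case/andP: zf.
have y1z : e y1 z by rewrite esym zy1.
have zz2 : z != z2.
  by apply/eqP => E; have := zy1 y2; rewrite E z2y2 eqxx eq_sym (negbTE y12n).
(* The order follows the labels of [U4_111]: the triangle, then the leaf of each corner in turn. *)
have us : uniq [:: u; y1; y2; x; z; z2].
  rewrite /= !inE !negb_or (neq _ _ uy1) (neq _ _ uy2) (neq _ _ ux) y12n y1x y2x zz2.
  rewrite ![u == _]eq_sym zu z2u ![_ == z]eq_sym ![_ == z2]eq_sym.
  by rewrite !farN.
have all v : v \in [:: u; y1; y2; x; z; z2].
  rewrite !inE; case: (eqVneq v u) => //= vu.
  case uv : (e u v).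
    by have := Nu _ uv; rewrite !inE => /or3P[]->; rewrite ?orbT.
  have vf : far e u v by rewrite /far vu uv.
  have [y uy vy] := farP _ vf; have yv : e y v by rewrite esym vy.
  have := Nu _ uy; rewrite !inE => /or3P[]/eqP yE; rewrite {}yE in uy vy yv.
  - by have := vy x; rewrite eqxx esym xu (negbTE vu).
  - have : v \in [:: u; y2; z].
      apply: (nbrs_seq (e := e) (v := y1)) yv; rewrite ?dy1 //.
        rewrite /= !inE negb_or (neq _ _ uy2) eq_sym zu andbT /=.
        by rewrite eq_sym farN.
      by move=> w; rewrite !inE => /or3P[]/eqP->; rewrite -topredE //= esym.
    by rewrite !inE (negbTE vu) /= => /orP[]->; rewrite ?orbT.
  have : v \in [:: u; y1; z2].
    apply: (nbrs_seq (e := e) (v := y2)) yv; rewrite ?dy2 //.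
      rewrite /= !inE negb_or (neq _ _ uy1) eq_sym z2u andbT /=.
      by rewrite eq_sym farN.
    by move=> w; rewrite !inE => /or3P[]/eqP->; rewrite -topredE //= esym.
  by rewrite !inE (negbTE vu) /= => /orP[]->; rewrite ?orbT.
apply: (graph_iso_seq us) => //.
  move=> x0 [i Hi] [j Hj]; case: i Hi => [|[|[|[|[|[|]]]]]] // Hi;
    case: j Hj => [|[|[|[|[|[|]]]]]] // Hj; rewrite /U4_111 /graph_of_edges //= => _ //;
    by rewrite esym ?zy1 ?z2y2.
have n6 : n = 6%N.
  by rewrite -[LHS]card_ord -[RHS](card_uniqP us); apply: eq_card => v; rewrite all.
by rewrite dsum n6 sum_deg_U4_111.
Qed.

(** The triangle uses up the whole excess: there is no other triangle at [u], and every far vertex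
    is a leaf. The equations then exclude a fourth neighbour of [u], and the two graphs differ by
    whether far vertices exist. *)
Lemma triangle_at_support x u y1 y2 : leaf_at e x u ->
  e u y1 -> e u y2 -> e y1 y2 -> graph_iso e U2_1 \/ graph_iso e U4_111.
Proof.
move=> xu uy1 uy2 y12; have [esym eirr] := es.
have cnt := excess_count u es dsum.
have /= fcom z := far_common (z := z) xu.
have neq v w : e v w -> v != w by move=> vw; apply: contraTneq vw => ->; rewrite eirr.
have ux : e u x by rewrite esym xu.
have y21 : e y2 y1 by rewrite esym.
have notx y w : e u y -> e y w -> w != x.
  by move=> uy; apply: contraTneq => ->; rewrite esym xu eq_sym (negbTE (neq _ _ uy)).
have y1x := notx _ _ uy2 y21; have y2x := notx _ _ uy1 y12; have y12n := neq _ _ y12.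
have farNx z y : far e u z -> e z y -> y != x.
  by move=> /andP[zu _]; apply: contraTneq => ->; rewrite esym xu.
have c1 : (0 < common e u y1)%N by apply/common_gt0P; exists y2.
have c2 : (0 < common e u y2)%N by apply/common_gt0P; exists y1.
move: cnt; rewrite (bigD1 y1) //= (bigD1 y2) /=; last by rewrite uy2 eq_sym.
set A := (\sum_(i | _ && _) _)%N; set B := (\sum_(i | far _ _ _) (_ + _))%N.
set m := (\sum_(i | _) 1)%N => cnt.
have Bm : (2 * m <= B)%N.
  rewrite /m big_distrr leq_sum //= => z zf.
  by move: (fcom _ zf); clear; lia.
have c11 : common e u y1 = 1%N by move: cnt c1 c2 Bm; clear; lia.
have c21 : common e u y2 = 1%N by move: cnt c1 c2 Bm; clear; lia.
have A0 : A = 0%N by move: cnt c1 c2 Bm; clear; lia.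
have tri0 w : e u w -> w != y1 -> w != y2 -> common e u w = 0%N.
  move=> uw w1 w2; move: A0; rewrite /A (bigD1 w) /= ?uw ?w1 ?w2 //.
  by move/eqP; rewrite addn_eq0 => /andP[/eqP].
have fT z : far e u z -> common e u z = 1%N /\ farnbr e u z = 0%N.
  move=> zf; have : (2 * common e u z + farnbr e u z = 2)%N.
    apply: (@sum_nat_tight _ (far e u)
       (fun z => 2 * common e u z + farnbr e u z)%N) zf.
      by move=> w wf; move: (fcom _ wf); clear; lia.
    by change (B <= 2 * m)%N; move: cnt c1 c2; clear; lia.
  by move: (fcom _ zf); clear; lia.
have farP z : far e u z -> exists y, [/\ e u y, leaf_at e z y & (d y)^-1 = K * d u].
  move=> zf; have [cz fz] := fT _ zf; have /common_gt0P[y uy zy] := fcom _ zf.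
  have dz : deg e z = 1%N by rewrite (far_deg zf) cz fz.
  exists y; split=> //; first exact: leaf_atP.
  by rewrite -(tsum1 R cz uy zy) (leaf_far xu zf) dz mulr1.
have E1 : (d y2)^-1 + a = K * d u * d y1.
  by rewrite -(leaf_near xu uy1 y1x) (tsum1 R c11 uy2 y12).
have E2 : (d y1)^-1 + a = K * d u * d y2.
  by rewrite -(leaf_near xu uy2 y2x) (tsum1 R c21 uy1 y21).
have uN : uniq [:: x; y1; y2] by rewrite /= !inE !negb_or ![x == _]eq_sym y1x y2x y12n.
have D3 : (3 <= deg e u)%N.
  by apply: leq_size_deg uN _ => w; rewrite !inE => /or3P[]/eqP->.
(* Suppose [u] has a further neighbour [w]. It lies in no triangle with [u], so
   [a = K * d u * d w]. *)
have [w /andP[uw]|noW] := pickP [pred w | e u w && (w \notin [:: x; y1; y2])].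
  rewrite !inE !negb_or => /and3P[wx w1 w2]; exfalso.
  have cw := tri0 _ uw w1 w2.
  have aE : a = K * d u * d w by rewrite -(leaf_near xu uw wx) tsum0 ?add0r.
  have a0 : a != 0 by rewrite aE mulf_neq0 ?coef_neq0 ?deg_neq0.
  have d12 : deg e y1 = deg e y2.
    apply/eqP; rewrite -(eqr_nat R) -(inj_eq (mulfI a0)); apply/eqP.
    have : d y1 * (d y1)^-1 + d y1 * a = d y2 * (d y2)^-1 + d y2 * a.
      by rewrite -!mulrDr E1 E2; ring.
    by rewrite !mulfV ?deg_neq0 // => /addrI; rewrite mulrC => ->; rewrite mulrC.
  have [dw2|dw1] := ltnP 1 (deg e w).
    have [|z wz] := @nbr_notin _ e w [:: u]; first exact: dw2.
    rewrite inE => zu.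
    have zf : far e u z.
      rewrite /far zu; apply/negP => uz; move/eqP: cw.
      by rewrite -leqn0 leqNgt => /negP; apply; apply/common_gt0P; exists z.
    have [y [uy zy yK]] := farP _ zf; have /eqP wy : w == y by rewrite -zy esym.
    rewrite -wy in yK; have a1 : a = 1 by rewrite aE -yK mulVf ?deg_neq0.
    move: E1; rewrite -yK a1 -d12 => E.
    (* If [w] carries a leaf, then [a = 1] and clearing denominators gives
       [d w * (1 + d y1) = d y1 ^ 2]; but [1 + d y1] is coprime to [d y1] and cannot divide it. *)
    have /eqP : (deg e w * (1 + deg e y1))%:R = (deg e y1 * deg e y1)%:R :> R.
      have := deg_neq0 w; have := deg_neq0 y1; rewrite !natrM natrD.
      move=> y0 w0; have -> : d y1 * d y1 = d w * d y1 * ((d w)^-1 * d y1) by field.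
      by rewrite -E; field.
    rewrite eqr_nat => /eqP dvd; have : ((1 + deg e y1) %| deg e y1 * deg e y1)%N.
      by rewrite -dvd dvdn_mull.
    have cop : coprime (1 + deg e y1) (deg e y1) by rewrite add1n coprimeSn.
    rewrite Gauss_dvdl // => /dvdn_leq; rewrite dpos => /(_ isT).
    by rewrite add1n ltnn.
  have dw : deg e w = 1%N by apply/eqP; rewrite eqn_leq dw1 dpos.
  move: aE; rewrite dw mulr1 => aK.
  (* Now [w] is a leaf and [a = K * d u]. The neighbour [y] of a far leaf would have degree 2 in the
     triangle or 1 outside it, too small in either case. *)
  have [z zf|nofar] := pickP (far e u).
    have [y [uy zy yK]] := farP _ zf; have yz : e y z by rewrite esym zy.
    have fy : (0 < farnbr e u y)%N by apply/farnbr_gt0P; exists z.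
    have zyy : e z y by rewrite esym.
    have yx := farNx _ _ zf zyy.
    have dy := deg_split u y es; rewrite uy in dy.
    have [y12E|/norP[yn1 yn2]] := boolP ((y == y1) || (y == y2)).
      have cy : common e u y = 1%N by case/orP: y12E => /eqP->.
      have dy1 : deg e y1 = deg e y by case/orP: y12E => /eqP->.
      move: E1; rewrite -d12 aK -yK dy1 => E.
      have : (deg e y = 2)%N.
        apply/eqP; rewrite -(eqr_nat R); apply/eqP; move: E.
        rewrite mulVf ?deg_neq0 // => E.
        have := deg_neq0 y; set t := d y in E * => t0.
        have : t * (t^-1 + t^-1) = t by rewrite E mulr1.
        by rewrite mulrDr mulfV // => <-.
      by move: dy fy; rewrite cy /=; clear; lia.
    have : (deg e y = 1)%N.
      apply/eqP; rewrite -(eqr_nat R) -(inj_eq (mulfI (coef_neq0 u))) mulr1.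
      by rewrite -(leaf_near xu uy yx) tsum0 ?add0r ?tri0 // aK.
    by move: dy fy; clear => /= ->; lia.
  have dy1 : deg e y1 = 2%N.
    rewrite (deg_split u y1 es) uy1 c11 /farnbr big_pred0 //.
  have dy2 : deg e y2 = 2%N by rewrite -d12.
  have y1u : e y1 u by rewrite esym.
  (* Without far vertices [y1] and [y2] have degree 2, so [a = 1/2] and [c = 0]; the diagonal entry
     at [y1] then gives [deg e u = 2], against [D3]. *)
  have := deg2_equation es cub dy1 y1u y12 (neq _ _ uy2).
  move: E1 (leaf_diag xu); rewrite uy2 dy1 dy2 -aK mulr1n /= => E1' Dg Eq.
  have ah : a = 2^-1 by lra.
  have D0 := deg_neq0 u; set D := d u in aK Dg Eq D0.
  have c0 : c = 0.
    by apply: (mulIf D0); rewrite mul0r; apply: (addrI a); rewrite addr0.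
  have : D * (2 * 1 * (D^-1 / 2) + a * (D^-1 + 2^-1) + 2 * c) = 4 * (K * D).
    by rewrite Eq; ring.
  rewrite -aK c0 ah => Eq'.
  have D2 : D = 2.
    have : D * (2 * 1 * (D^-1 / 2) + 2^-1 * (D^-1 + 2^-1) + 2 * 0)
       = 1 + 2^-1 + D * 4^-1 by field.
    rewrite Eq' => E; lra.
  by move/eqP: D2; rewrite /D eqr_nat => /eqP D2; rewrite D2 in D3.
have Nu w : e u w -> w \in [:: x; y1; y2].
  by move=> uw; have := noW w; rewrite /= uw => /negbFE.
have [z zf|nofar] := pickP (far e u).
  have farP' v : far e u v -> exists2 y, e u y & leaf_at e v y.
    by move=> /farP[y [uy vy _]]; exists y.
  right; have [y uy zy] := farP' _ zf.
  have yx : y != x by apply: (farNx _ _ zf); rewrite zy.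
  have := Nu _ uy; rewrite !inE (negbTE yx) /= => /orP[]/eqP yE; rewrite {}yE in zy.
    exact: (pendant_triangle xu uy1 uy2 y12 Nu farP' E1 E2 zf zy).
  apply: (pendant_triangle xu uy2 uy1 y21 _ farP' E2 E1 zf zy) => v /Nu.
  by rewrite !inE => /or3P[]->; rewrite ?orbT.
left; have us : uniq [:: u; y1; y2; x].
  by rewrite /= !inE !negb_or (neq _ _ uy1) (neq _ _ uy2) (neq _ _ ux) y12n y1x y2x.
have all v : v \in [:: u; y1; y2; x].
  rewrite !inE; case: (eqVneq v u) => //= vu.
  have := nofar v; rewrite /far vu /= => /negbFE /Nu.
  by rewrite !inE => /or3P[]->; rewrite ?orbT.
apply: (graph_iso_seq us) => //.
  move=> x0 [i Hi] [j Hj]; case: i Hi => [|[|[|[|]]]] // Hi;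
    case: j Hj => [|[|[|[|]]]] // Hj; rewrite /U2_1 /graph_of_edges //= => _ //;
    by rewrite esym.
have n4 : n = 4%N.
  by rewrite -[LHS]card_ord -[RHS](card_uniqP us); apply: eq_card => v; rewrite all.
by rewrite dsum n4 sum_deg_U2_1.
Qed.

Lemma leaf_classification x u : leaf_at e x u ->
  graph_iso e U2_1 \/ graph_iso e U4_111.
Proof.
move=> xu.
have [y1 /andP[uy1 /common_gt0P[y2 uy2 y12]]|no] :=
  pickP [pred y | e u y && (0 < common e u y)%N].
  exact: triangle_at_support xu uy1 uy2 y12.
case: (no_triangle_at_support xu) => y uy.
by have := no y; rewrite /= uy lt0n => /negbFE/eqP.
Qed.

End LeafAnalysis.

(** * Two-regular connected graphs are cycles *)

Lemma cycle_graphE (n : nat) (i j : 'I_n.+1) :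
  cycle_graph i j = (j == ordS i) || (j == ord_pred i).
Proof.
rewrite /cycle_graph; congr orb.
by rewrite -[j == ord_pred i](inj_eq (can_inj (@ordSK n.+1))) ord_predK eq_sym.
Qed.

Lemma ordS_neq_pred (n : nat) (i : 'I_n.+3) : ordS i != ord_pred i.
Proof.
rewrite -(inj_eq (can_inj (@ordSK _))) ord_predK -val_eqE /=; case: i => i /= Hi.
rewrite -addn1 modnDml addn1.
have [lt|ge] := ltnP i.+2 n.+3; first by rewrite modn_small //; lia.
have -> : (i.+2 = n.+3 + (i - n.+1))%N by lia.
by rewrite modnDl modn_small; lia.
Qed.

Lemma sum_cycle_nbrs (R : nmodType) (n : nat) (i : 'I_n.+3) (F : 'I_n.+3 -> R) :
  \sum_(j | cycle_graph i j) F j = F (ordS i) + F (ord_pred i).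
Proof.
rewrite (bigD1 (ordS i)) /=; last by rewrite cycle_graphE eqxx.
rewrite (bigD1 (ord_pred i)) /=; last first.
  by rewrite cycle_graphE eqxx orbT eq_sym ordS_neq_pred.
rewrite big1 ?addr0 // => j /andP[/andP[]]; rewrite cycle_graphE.
by case/orP => ->.
Qed.

Lemma deg_cycle (n : nat) (i : 'I_n.+3) : deg (@cycle_graph n.+3) i = 2%N.
Proof.
apply/eqP; rewrite -(eqr_nat rat) -sum1_deg sum_cycle_nbrs.
by [].
Qed.

Lemma deg_cycle_ge2 (n : nat) (i : 'I_n) : (2 < n)%N -> (1 < deg (@cycle_graph n) i)%N.
Proof. by case: n i => [|[|[|n]]] // i _; rewrite deg_cycle. Qed.

(** Walk without turning back until a vertex repeats. The repeated vertex is the start, the visited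
    set is closed under adjacency, and connectedness makes it everything. *)
Lemma two_regular_cycle (n : nat) (e : rel 'I_n) : simple_graph e ->
  connected_graph e -> (forall x, deg e x = 2%N) -> (0 < n)%N ->
  (2 < n)%N /\ graph_iso e (@cycle_graph n).
Proof.
move=> [esym eirr] econ d2 n0; pose x0 : 'I_n := Ordinal n0.
pose nxt p c := odflt c [pick w | e c w && (w != p)].
have nxtP p c : e c (nxt p c) && (nxt p c != p).
  rewrite /nxt; case: pickP => [w -> //|no].
  have [|w cw] := @nbr_notin _ e c [:: p]; first by rewrite d2.
  by rewrite inE => wp; have := no w; rewrite cw wp.
(* The state is the pair of previous and current vertex. Taking [x0] as its own predecessor leaves
   the first move free, since there are no loops. *)
pose step (q : 'I_n * 'I_n) := (q.2, nxt q.1 q.2).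
pose f k := (iter k step (x0, nxt x0 x0)).1.
have fS k : f k.+1 = (iter k step (x0, nxt x0 x0)).2 by [].
have fSS k : f k.+2 = nxt (f k) (f k.+1) by [].
have adj k : e (f k) (f k.+1).
  case: k => [|k]; first by case/andP: (nxtP x0 x0).
  by rewrite fSS; case/andP: (nxtP (f k) (f k.+1)).
have nb k : f k.+2 != f k by rewrite fSS; case/andP: (nxtP (f k) (f k.+1)).
have adjP k : e (f k.+1) (f k) by rewrite esym.
have Nf k y : e (f k.+1) y -> (y == f k) || (y == f k.+2).
  by rewrite (deg2_nbrs (d2 _) (adjP k) (adj k.+1)) // eq_sym nb.
have ex : exists j, ~~ uniq (mkseq f j).
  exists n.+1; apply/negP => /card_uniqP; rewrite size_mkseq => E.
  by have := max_card (mem (mkseq f n.+1)); rewrite E card_ord ltnn.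
case: (ex_minnP ex) => -[|k] // nuk mink.
have uk : uniq (mkseq f k) by apply/negPn/negP => /mink; rewrite ltnn.
have finj i j : (i < k)%N -> (j < k)%N -> f i = f j -> i = j.
  move=> ik jk fij; apply/eqP; rewrite -(nth_uniq x0 _ _ uk) ?size_mkseq //.
  by rewrite !nth_mkseq // fij.
have smem y : reflect (exists2 j, (j < k)%N & y = f j) (y \in mkseq f k).
  rewrite /mkseq; apply: (iffP mapP) => -[j jk ->]; exists j => //; move: jk;
    by rewrite mem_iota.
move: nuk; rewrite mkseqS rcons_uniq uk andbT negbK => /smem[i ik fki].
have fneq j : f j.+1 != f j by apply: contraTneq (adj j) => ->; rewrite eirr.
(* A return to a later vertex [f i.+1] would come from one of its two neighbours [f i] or [f i.+2],
   contradicting either injectivity so far or the ban on turning back. *)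
have fk0 : f k = f 0%N.
  case: i ik fki => [|i] // ik fki.
  case: k ik fki finj {uk mink smem} => [|k] // ik fki finj.
  have : e (f i.+1) (f k) by rewrite -fki.
  move/Nf => /orP[]/eqP E.
    by have := finj k i (ltnSn _) (ltnW ik) E; move: ik; clear; lia.
  have ik' : (i.+2 < k.+1)%N.
    rewrite ltn_neqAle ik andbT; apply/eqP => ikE.
    by have := fneq i.+1; rewrite ikE fki eqxx.
  have := finj k i.+2 (ltnSn _) ik' E => kE.
  by have := nb i.+1; rewrite -kE fki eqxx.
have k3 : (2 < k)%N.
  case: k fk0 ik {finj fki uk mink smem} => [|[|[|]]] // fk0.
    by have := fneq 0%N; rewrite fk0 eqxx.
  by have := nb 0%N; rewrite fk0 eqxx.
pose s := mkseq f k.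
have ins j : (j < k)%N -> f j \in s by move=> jk; apply/smem; exists j.
have clos y z : y \in s -> e y z -> z \in s.
  case/smem => -[|j] jk -> yz.
    have f0k1 : e (f 0%N) (f k.-1) by rewrite -fk0 -{1}(prednK (ltnW (ltnW k3))).
    have f1k1 : f 1%N != f k.-1.
      by apply/eqP => /finj; move: k3; clear => k3 H; have := H _ _; lia.
    have : (z == f 1%N) || (z == f k.-1).
      by rewrite -(deg2_nbrs (d2 _) (adj 0%N) f0k1 f1k1).
    by case/orP => /eqP->; apply: ins; move: k3; clear; lia.
  case/orP: (Nf _ _ yz) => /eqP->; first by apply: ins; exact: ltnW.
  have [lt|ge] := ltnP j.+2 k; first exact: ins.
  have -> : j.+2 = k by apply/eqP; rewrite eqn_leq jk ge.
  by rewrite fk0 ins // (leq_trans _ k3).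
have all y : y \in s.
  have lastP p x : x \in s -> path e x p -> last x p \in s.
    by elim: p x => //= w p IH x xs /andP[/(clos _ _ xs) ws]; apply: IH.
  have /connectP[p pp ->] := econ x0 y; apply: lastP pp.
  by apply: (ins 0%N); rewrite (leq_trans _ k3).
have kn : k = n.
  by rewrite -[RHS]card_ord -(size_mkseq f k) -(card_uniqP uk); apply: eq_card => y; rewrite all.
split; first by rewrite -kn.
apply: (graph_iso_seq uk) => //; first by rewrite size_mkseq.
  have half (i' j : 'I_n) y0 : (j : nat) == (i'.+1 %% n)%N ->
      e (nth y0 (mkseq f k) i') (nth y0 (mkseq f k) j).
    move=> /eqP jE; rewrite !nth_mkseq ?kn // jE.
    have [lt|ge] := ltnP i'.+1 n; first by rewrite modn_small.
    have iE : i'.+1 = n by apply/eqP; rewrite eqn_leq ge ltn_ord.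
    rewrite iE modnn -fk0; have -> : k = i'.+1 by rewrite iE.
    exact: adj.
  by move=> y0 i' j /orP[/half //|/half]; rewrite esym.
apply: leq_sum => i' _; rewrite d2.
by rewrite deg_cycle_ge2 // -kn.
Qed.

(** * Walk eigenvalues, their invariance, and cycles *)

Definition walk_eigenvalue (R : rcfType) (n : nat) (e : rel 'I_n) (l : R) :=
  exists v : 'I_n -> R, (exists x, v x != 0) /\
    forall z, \sum_(y | e z y) v y = l * (deg e z)%:R * v z.

Lemma graph_iso_sym (n m : nat) (e : rel 'I_n) (e' : rel 'I_m) :
  graph_iso e e' -> graph_iso e' e.
Proof.
case=> f [[g fK gK] fe]; exists g; split; first by exists f.
by move=> x y; rewrite -fe !gK.
Qed.

Lemma walk_eigenvalue_iso (R : rcfType) (n m : nat) (e : rel 'I_n)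
    (e' : rel 'I_m) (l : R) :
  graph_iso e e' -> walk_eigenvalue e l -> walk_eigenvalue e' l.
Proof.
case=> f [fbij fe] [v [[x vx] vE]]; have [g fK gK] := fbij.
have sumE (F : 'I_m -> R) z : \sum_(y | e' z y) F y = \sum_(y | e (g z) y) F (f y).
  rewrite (reindex f) /=; last exact: onW_bij.
  by apply: eq_bigl => y; rewrite -fe gK.
exists (v \o g); split; first by exists (f x); rewrite /= fK.
move=> z; rewrite -sum1_deg !sumE sum1_deg -vE.
by apply: eq_bigr => y _; rewrite /= fK.
Qed.

Lemma num_distinct_walk (R : rcfType) (n : nat) (e : rel 'I_n) (k : nat)
    (t : seq R) :
  symmetric e -> (forall x, (0 < deg e x)%N) -> uniq t -> size t = k ->
  (forall l, walk_eigenvalue e l <-> l \in t) ->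
  num_distinct_eigenvalues_eq (norm_lap R e) k.
Proof.
move=> esym dpos ut st tP; have sub_inj : injective (fun l : R => 1 - l).
  by move=> l l' /(congr1 (fun y => 1 - y)); rewrite !subKr.
exists [seq 1 - l | l <- t]; split; rewrite ?map_inj_uniq ?size_map // => a.
have -> : a \in [seq 1 - l | l <- t] = (1 - a \in t).
  by rewrite -[in RHS](mem_map sub_inj) subKr.
by rewrite -tP eigenvalue_norm_lapP.
Qed.

(** The [k] values [1 - a] are distinct roots of a nonzero polynomial. This rules out four
    eigenvalues whenever a cubic annihilates the walk spectrum. *)
Lemma num_distinct_annihilated (R : rcfType) (n : nat) (e : rel 'I_n) (k : nat)
    (p : seq R) :
  symmetric e -> (forall x, (0 < deg e x)%N) ->
  num_distinct_eigenvalues_eq (norm_lap R e) k ->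
  (forall l, walk_eigenvalue e l -> (Poly p).[l] = 0) ->
  Poly p != 0 -> (k < size p)%N.
Proof.
move=> esym dpos [s [us ss sP]] pP p0; have sub_inj : injective (fun l : R => 1 - l).
  by move=> l l' /(congr1 (fun y => 1 - y)); rewrite !subKr.
rewrite -ss -(size_map (fun l : R => 1 - l) s); apply: (leq_trans _ (size_Poly p)).
apply: max_poly_roots => //; last by rewrite map_inj_uniq.
apply/allP => _ /mapP[a /sP /(eigenvalue_norm_lapP _ esym dpos) aP ->].
exact/eqP/pP.
Qed.

(** A vector on the cycle unrolled to a periodic sequence, so that the eigenvalue equation becomes a
    linear recurrence on [nat]. *)
Definition cycle_seq (R : rcfType) (n : nat) (v : 'I_n.+3 -> R) (k : nat) : R :=
  v (inord (k %% n.+3)).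

Lemma cycle_seq_periodic (R : rcfType) (n : nat) (v : 'I_n.+3 -> R) (k : nat) :
  cycle_seq v (k + n.+3) = cycle_seq v k.
Proof. by rewrite /cycle_seq modnDr. Qed.

Lemma cycle_seq_rec (R : rcfType) (n : nat) (v : 'I_n.+3 -> R) (l : R) :
  (forall z, \sum_(y | cycle_graph z y) v y =
             l * (deg (@cycle_graph n.+3) z)%:R * v z) ->
  forall k, cycle_seq v k.+2 = 2 * l * cycle_seq v k.+1 - cycle_seq v k.
Proof.
move=> vE k; have val_inord j : val (inord (j %% n.+3) : 'I_n.+3) = (j %% n.+3)%N.
  by rewrite /= inordK // ltn_mod.
have S j : inord (j.+1 %% n.+3) = ordS (inord (j %% n.+3) : 'I_n.+3).
  by apply: val_inj; rewrite val_inord /= val_inord -[in RHS]addn1 modnDml addn1.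
have := vE (inord (k.+1 %% n.+3)); rewrite sum_cycle_nbrs deg_cycle -S.
have -> : ord_pred (inord (k.+1 %% n.+3)) = inord (k %% n.+3) :> 'I_n.+3.
  by rewrite S ordSK.
by rewrite -!/(cycle_seq v _) [2 * l]mulrC => <-; rewrite addrK.
Qed.

(* Chebyshev polynomials of the first kind, up to degree 4 (junk 0 beyond). *)
Definition cheb (R : rcfType) (l : R) (j : nat) : R :=
  nth 0 [:: 1; l; 2 * l ^+ 2 - 1; 4 * l ^+ 3 - 3 * l; 8 * l ^+ 4 - 8 * l ^+ 2 + 1] j.

(** The analogue of [cos (t - j s) + cos (t + j s) = 2 cos (j s) cos t] for any solution of the
    recurrence. *)
Lemma cheb_rec (R : rcfType) (l : R) (g : nat -> R) (m j : nat) :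
  (forall k, g k.+2 = 2 * l * g k.+1 - g k) -> (j < 5)%N ->
  g m + g (m + 2 * j)%N = 2 * cheb l j * g (m + j)%N.
Proof.
move=> gE; rewrite ![(m + _)%N]addnC.
by case: j => [|[|[|[|[|]]]]] // _; rewrite /cheb /muln /addn /= ?gE; ring.
Qed.

(* The two vertices at distance [i] from [x] are those at distance [n - i], and
   an eigenvector takes the sum [2 T_i(l) v(x)] on them. *)
Lemma cycle_walk_eigenvalue (R : rcfType) (n : nat) (l : R) (i j : nat) :
  (i < 5)%N -> (j < 5)%N -> (i + j = n.+3)%N ->
  walk_eigenvalue (@cycle_graph n.+3) l -> cheb l i = cheb l j.
Proof.
move=> i5 j5 ij [v [[x vx] vE]]; have gE := cycle_seq_rec vE.
wlog le : i j i5 j5 ij / (i <= j)%N.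
  by move=> H; case: (leqP i j) => [|/ltnW] le; [|apply/esym]; apply: H; rewrite // addnC.
have [m mx] : exists m, cycle_seq v (m + j) = v x.
  (* Chosen so that [m + j = x + j * n.+3], congruent to [x], without subtraction. *)
  exists (x + j * n.+2)%N; rewrite -addnA -[X in (_ + (_ + X))%N]muln1 -mulnDr addn1.
  rewrite /cycle_seq addnC modnMDl modn_small ?ltn_ord //.
  by rewrite inord_val.
have := cheb_rec m gE j5; have := cheb_rec (m + (j - i)) gE i5.
have -> : (m + (j - i) + 2 * i = m + n.+3)%N by lia.
have -> : (m + (j - i) + i = m + j)%N by lia.
have -> : (m + 2 * j = m + (j - i) + n.+3)%N by lia.
rewrite !cycle_seq_periodic mx [_ + cycle_seq v m]addrC => -> /(mulIf vx).
by apply: mulfI; rewrite pnatr_eq0.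
Qed.

(** When [x] and [z] are distinct and joined by no walk of length 1 or 2, only the cubic term can
    produce the nonzero entry [K * deg e z]. *)
Lemma cubic_walk_diameter (R : rcfType) (n : nat) (e : rel 'I_n) (a b c K : R)
    (x z : 'I_n) :
  cubic_walk e a b c K -> (0 < deg e z)%N -> x != z -> ~~ e x z ->
  (forall y, e x y -> ~~ e y z) ->
  exists y w, [&& e x y, e y w & e w z].
Proof.
move=> [K0 cub] dz /negbTE xz /negbTE exz no2.
have [y /existsP[w]|no3] := pickP [pred y | [exists w, [&& e x y, e y w & e w z]]].
  by exists y, w.
have := cub x z; have P2 : (walk_mx R e *m walk_mx R e) x z = 0.
  rewrite mxE big1 // => y _; rewrite !mxE.
  by case exy: (e x y); rewrite ?mul0r // (negbTE (no2 y exy)) mul0r mulr0.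
rewrite P2 mxE big1 => [|w _]; last first.
  rewrite mxE mulr_suml big1 // => y _; rewrite !mxE.
  have /negbT := no3 y; rewrite negb_exists => /forallP/(_ w).
  by case: (e x y); case: (e y w); case: (e w z); rewrite ?mul0r ?mulr0 ?mul0r.
rewrite mxE exz xz !(mul0r, mulr0, addr0) => /esym/eqP.
by rewrite mulf_eq0 (negbTE K0) pnatr_eq0 eqn0Ngt dz.
Qed.

Lemma cycle_graph_nat (n : nat) (i j : 'I_n) : cycle_graph i j ->
  [\/ j = i.+1 :> nat, i = j.+1 :> nat, i = 0%N :> nat /\ j = n.-1 :> nat
    | j = 0%N :> nat /\ i = n.-1 :> nat].
Proof.
have S (k k' : 'I_n) : (k' : nat) == (k.+1 %% n)%N ->
    k' = k.+1 :> nat \/ k' = 0%N :> nat /\ k = n.-1 :> nat.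
  move/eqP=> ->; have [lt|ge] := ltnP k.+1 n; first by left; rewrite modn_small.
  have kn : k.+1 = n by apply/eqP; rewrite eqn_leq ge ltn_ord.
  by right; split; [rewrite kn modnn | move/(congr1 predn): kn].
case/orP => /S [?|?]; [exact: Or41|exact: Or44|exact: Or42|exact: Or43].
Qed.

Lemma cycle_walk3 (n : nat) (i j k l : 'I_n) : (7 < n)%N ->
  cycle_graph i j -> cycle_graph j k -> cycle_graph k l ->
  i = 0%N :> nat -> l = 4%N :> nat -> False.
Proof.
move=> n7 /cycle_graph_nat ij /cycle_graph_nat jk /cycle_graph_nat kl i0 l4.
move: ij jk kl; rewrite i0 l4; move: (nat_of_ord j) (nat_of_ord k) n7; clear.
by move=> j k n7 [|||] ? [|||] ? [|||] ?; lia.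
Qed.

Lemma cycle_classification (R : rcfType) (n : nat) (e : rel 'I_n) :
  simple_graph e -> (forall x, (0 < deg e x)%N) -> connected_graph e ->
  num_distinct_eigenvalues_eq (norm_lap R e) 4 ->
  (2 < n)%N -> graph_iso e (@cycle_graph n) ->
  graph_iso e (@cycle_graph 6) \/ graph_iso e (@cycle_graph 7).
Proof.
move=> [esym eirr] dpos econ e4 n3 iso.
have ann (p : seq R) : size p = 4%N -> Poly p != 0 ->
    (forall l, walk_eigenvalue (@cycle_graph n) l -> (Poly p).[l] = 0) -> False.
  move=> p4 p0 pP; have := num_distinct_annihilated (p := p) esym dpos e4.
  rewrite p4 ltnn => H; apply: notF; apply: H => // l.
  by move=> /(walk_eigenvalue_iso iso); exact: pP.
have pn0 (p : seq R) x : (Poly p).[x] != 0 -> Poly p != 0.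
  by apply: contra_neq => ->; rewrite horner0.
have [n7|n8] := leqP n 7; last first.
  have [a [b [c [K cub]]]] := walk_mx_cubic esym econ dpos e4.
  have [f [[g fK gK] fe]] := iso.
  pose i0 := Ordinal (leq_trans (isT : 0 < 8)%N n8).
  pose i4 := Ordinal (leq_trans (isT : 4 < 8)%N n8).
  have eE x y : e x y = cycle_graph (f x) (f y) by rewrite fe.
  have cs (i j : 'I_n) : cycle_graph i j = cycle_graph j i by rewrite /cycle_graph orbC.
  have [||y|y [w]] := cubic_walk_diameter (x := g i0) (z := g i4) cub (dpos _).
  - by rewrite (can_eq gK).
  (* An edge is read as the walk of length three that goes back and forth along it. *)
  - rewrite eE !gK; apply/negP => h.
    by apply: (cycle_walk3 n8 h (j := i4) (k := i0) (l := i4)); rewrite // cs.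
  - rewrite !eE !gK => h1; apply/negP => h2.
    have /cycle_graph_nat /= := h1; have /cycle_graph_nat /= := h2.
    by move: (nat_of_ord (f y)) (n8); clear => k n8 [|||] ? [|||] ?; lia.
  rewrite !eE !gK => /and3P[h1 h2 h3]; case: (cycle_walk3 n8 h1 h2 h3) => //.
clear esym eirr dpos econ e4.
case: n e n3 n7 iso ann => [|[|[|[|[|[|[|[|n]]]]]]]] // e _ _ iso ann.
(* The lists are the coefficients, constant term first, of [T_2 - T_1], [T_3 - T_1] and [T_3 - T_2],
   for 3, 4 and 5 vertices; the first is padded to length 4. *)
- exfalso; apply: (ann [:: -1; -1; 2; 0]) => // [|l /(cycle_walk_eigenvalue (i := 2) (j := 1)) H].
    by apply: (pn0 _ 0); rewrite horner_Poly /=; apply/eqP; lra.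
  by have := H isT isT erefl; rewrite /cheb horner_Poly /= => E; lra.
- exfalso; apply: (ann [:: 0; -4; 0; 4]) => // [|l /(cycle_walk_eigenvalue (i := 3) (j := 1)) H].
    by apply: (pn0 _ 2); rewrite horner_Poly /=; apply/eqP; lra.
  by have := H isT isT erefl; rewrite /cheb horner_Poly /= => E; lra.
- exfalso; apply: (ann [:: 1; -3; -2; 4]) => // [|l /(cycle_walk_eigenvalue (i := 3) (j := 2)) H].
    by apply: (pn0 _ 0); rewrite horner_Poly /=; apply/eqP; lra.
  by have := H isT isT erefl; rewrite /cheb horner_Poly /= => E; lra.
- by left.
- by right.
Qed.

(** * Spectra of the four graphs *)

(** For a concrete graph the neighbour lists [N] are found by computation, which turns the
    eigenvalue problem into explicit linear equations. *)
Lemma walk_eigenvalue_nbrs (R : rcfType) (n : nat) (e : rel 'I_n.+1)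
    (r : rel nat) (N : seq (seq nat)) (l : R) :
  (forall x y : 'I_n.+1, e x y = r x y) ->
  [seq [seq y <- iota 0 n.+1 | r z y] | z <- iota 0 n.+1] = N ->
  walk_eigenvalue e l <->
  exists w : nat -> R, (exists2 x, (x < n.+1)%N & w x != 0) /\
    forall z, (z < n.+1)%N ->
      \sum_(y <- nth [::] N z) w y = l * (size (nth [::] N z))%:R * w z.
Proof.
move=> er <-; set M := map _ _.
have ME z : (z < n.+1)%N -> nth [::] M z = [seq y <- iota 0 n.+1 | r z y].
  by move=> zn; rewrite (nth_map 0%N) ?size_iota // nth_iota.
have sumE (F : nat -> R) (z : 'I_n.+1) :
    \sum_(y | e z y) F y = \sum_(y <- nth [::] M z) F y.
  rewrite ME // big_filter -[iota _ _]/(index_iota 0 n.+1) big_mkord.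
  by apply: eq_bigl => y; rewrite er.
have degE (z : 'I_n.+1) : (deg e z)%:R = (size (nth [::] M z))%:R :> R.
  by rewrite -sum1_deg (sumE (fun=> 1)) big_const_seq count_predT iter_addr_0.
split.
  case=> v [[x vx] vE]; exists (fun k => v (inord k)); split.
    by exists x; rewrite ?inord_val.
  move=> z zn; have := vE (Ordinal zn); rewrite degE.
  have -> : v (Ordinal zn) = v (inord z) by congr v; apply: val_inj; rewrite /= inordK.
  move=> <-; rewrite -(sumE (fun k => v (inord k)) (Ordinal zn)).
  by apply: eq_bigr => y _; rewrite inord_val.
case=> w [[x xn wx] wE]; exists (fun y : 'I_n.+1 => w y); split.
  by exists (Ordinal xn).
by move=> z; rewrite sumE degE wE.
Qed.

Lemma walk_eigenvalue_const (R : rcfType) (n : nat) (e : rel 'I_n.+1) :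
  walk_eigenvalue e (1 : R).
Proof.
exists (fun=> 1); split; first by exists ord0; exact: oner_neq0.
by move=> z; rewrite sum1_deg mul1r mulr1.
Qed.

Lemma walk_spectrum_C6 (R : rcfType) :
  exists t : seq R, [/\ uniq t, size t = 4%N &
    forall l, walk_eigenvalue (@cycle_graph 6) l <-> l \in t].
Proof.
exists [:: 1; -1; 2^-1; - 2^-1]; split=> // [|l].
  rewrite /= !inE !negb_or -!andbA andbT.
  by do !(apply/andP; split); apply/eqP; lra.
split.
  move/(cycle_walk_eigenvalue (i := 4) (j := 2)) => /(_ isT isT erefl).
  rewrite /cheb /= => E.
  have /eqP : (l - 1) * (l + 1) * (l - 2^-1) * (l + 2^-1) = 0 by lra.
  rewrite !mulf_eq0 !subr_eq0 !addr_eq0 !inE.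
  by case/orP => [/orP[/orP[]|]|] ->; rewrite ?orbT.
have W := @walk_eigenvalue_nbrs R 5 (@cycle_graph 6) (fun x y =>
  (y == (x.+1 %% 6)%N) || (x == (y.+1 %% 6)%N)) _ l (fun _ _ => erefl) erefl.
move=> lt; apply/W; pose T2 := 2 * l ^+ 2 - 1; pose T3 := 4 * l ^+ 3 - 3 * l.
(* The entry at distance [j] from vertex 0 is [T_j(l)]; only the equation at the antipode imposes a
   condition on [l]. *)
exists (fun k => nth 0 [:: 1; l; T2; T3; T2; l] k); split.
  by exists 0%N => //; exact: oner_neq0.
have T : 2 * T2 = l * 2 * T3.
  by move: lt; rewrite /T2 /T3 !inE => /or4P[]/eqP->; field.
by move=> [|[|[|[|[|[|]]]]]] //= _; rewrite !big_cons big_nil /=; rewrite /T2 /T3 in T *; lra.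
Qed.

(** [T_4 - T_3 = (l - 1) p], where [p] is up to scaling the minimal polynomial of [cos (2 pi / 7)].
    Its three roots come from the sign changes at -1, -1/2, 0 and 1. *)
Lemma walk_spectrum_C7 (R : rcfType) :
  exists t : seq R, [/\ uniq t, size t = 4%N &
    forall l, walk_eigenvalue (@cycle_graph 7) l <-> l \in t].
Proof.
pose p : {poly R} := Poly [:: -1; -4; 4; 8].
have pE x : p.[x] = 8 * x ^+ 3 + 4 * x ^+ 2 - 4 * x - 1.
  by rewrite /p horner_Poly /=; ring.
have p0 : p != 0.
  have : p.[0] != 0 by rewrite pE; apply/eqP; lra.
  by apply: contra_neq => ->; rewrite horner0.
have [||r1 /andP[r1a r1b] /rootP] := @poly_ivt R p (-1) (- 2^-1).
- by lra.
- by rewrite !pE; apply/andP; split; lra.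
rewrite pE => r10.
have [||r2 /andP[r2a r2b] /rootP] := @poly_ivt R (- p) (- 2^-1) 0.
- by lra.
- by rewrite !hornerN !pE; apply/andP; split; lra.
rewrite hornerN pE => r20.
have [||r3 /andP[r3a r3b] /rootP] := @poly_ivt R p 0 1.
- by lra.
- by rewrite !pE; apply/andP; split; lra.
rewrite pE => r30.
have r12 : r1 < r2.
  rewrite lt_neqAle; apply/andP; split; last by lra.
  apply/eqP => r12; have E : r1 = - 2^-1 by lra.
  by move: r10; rewrite E; lra.
have r23 : r2 < r3.
  rewrite lt_neqAle; apply/andP; split; last by lra.
  apply/eqP => r23; have E : r3 = 0 by lra.
  by move: r30; rewrite E; lra.
have r31 : r3 < 1.
  rewrite lt_neqAle; apply/andP; split; last by lra.
  by apply/eqP => E; move: r30; rewrite E; lra.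
have u3 : uniq [:: r1; r2; r3].
  by rewrite /= !inE !negb_or !lt_eqF // (lt_trans r12).
exists [:: 1; r1; r2; r3]; split=> // [|l].
  by rewrite cons_uniq u3 andbT !inE !negb_or !gt_eqF //; lra.
have pr r : r \in [:: r1; r2; r3] -> p.[r] = 0.
  by rewrite !inE pE => /or3P[]/eqP->; lra.
split.
  move/(cycle_walk_eigenvalue (i := 4) (j := 3)) => /(_ isT isT erefl).
  rewrite /cheb /= => E; rewrite in_cons; apply/orP.
  have /eqP : (l - 1) * p.[l] = 0 by rewrite pE; lra.
  rewrite mulf_eq0 subr_eq0 => /orP[->|pl]; first by left.
  right; apply/negPn/negP => ln.
  have := @max_poly_roots _ p (l :: [:: r1; r2; r3]) p0.
  rewrite cons_uniq ln u3 => H.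
  suff : (4 < size p)%N by rewrite ltnNge (size_Poly [:: -1; -4; 4; 8 : R]).
  apply: H => //; apply/allP => r; rewrite in_cons => /orP[/eqP->|/pr rr] //.
  exact/eqP.
have W := @walk_eigenvalue_nbrs R 6 (@cycle_graph 7) (fun x y =>
  (y == (x.+1 %% 7)%N) || (x == (y.+1 %% 7)%N)) _ l (fun _ _ => erefl) erefl.
rewrite in_cons => /orP[/eqP-> | /pr]; first exact: walk_eigenvalue_const.
rewrite pE => E; apply/W.
pose T2 := 2 * l ^+ 2 - 1; pose T3 := 4 * l ^+ 3 - 3 * l.
exists (fun k => nth 0 [:: 1; l; T2; T3; T3; T2; l] k); split.
  by exists 0%N => //; exact: oner_neq0.
have T : T2 + T3 = l * 2 * T3.
  have : (l - 1) * (8 * l ^+ 3 + 4 * l ^+ 2 - 4 * l - 1) = 0 by rewrite E mulr0.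
  by rewrite /T2 /T3; lra.
by move=> [|[|[|[|[|[|[|]]]]]]] //= _; rewrite !big_cons big_nil /=; rewrite /T2 /T3 in T *; lra.
Qed.

Lemma walk_spectrum_U2_1 (R : rcfType) :
  exists t : seq R, [/\ uniq t, size t = 4%N &
    forall l, walk_eigenvalue U2_1 l <-> l \in t].
Proof.
pose s : R := Num.sqrt 33; have s2 : s ^+ 2 = 33 by rewrite sqr_sqrtr // ler0n.
have s0 : 0 < s by rewrite sqrtr_gt0 ltr0n.
pose r1 := (-3 + s) / 12; pose r2 := (-3 - s) / 12.
have rE l : (l \in [:: r1; r2]) = (6 * l ^+ 2 + 3 * l - 1 == 0).
  have -> : 6 * l ^+ 2 + 3 * l - 1 = 6 * ((l - r1) * (l - r2)).
    by rewrite /r1 /r2; lra.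
  by rewrite !inE !mulf_eq0 !subr_eq0 pnatr_eq0.
have W l := @walk_eigenvalue_nbrs R 3 U2_1 (fun x y => let s := [:: (0,1); (1,2); (0,2); (0,3)]%N in
  ((x, y) \in s) || ((y, x) \in s)) _ l (fun _ _ => erefl) erefl.
exists [:: 1; - 2^-1; r1; r2]; split=> // [|l].
  rewrite cons_uniq in_cons rE cons_uniq rE /= inE !andbT negb_or -andbA.
  by apply/and4P; split; apply/eqP; rewrite /r1 /r2; lra.
rewrite 2!in_cons rE; split.
  case/W => w [[x xn wx] wE].
  have E0 := wE 0%N isT; have E1 := wE 1%N isT; have E2 := wE 2%N isT; have E3 := wE 3%N isT.
  move: E0 E1 E2 E3; rewrite /= !big_cons !big_nil => E0 E1 E2 E3.
  (* Swapping vertices 1 and 2 is a symmetry: the antisymmetric part gives [- 1/2], the symmetric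
     part the other three eigenvalues. *)
  have : (2 * l + 1) * (w 1%N - w 2%N) = 0 by lra.
  move/eqP; rewrite mulf_eq0 => /orP[/eqP l2|/eqP w12].
    have -> : l = - 2^-1 by lra.
    by rewrite eqxx orbT.
  have w21 : w 2%N = w 1%N by lra.
  have w01 : w 0%N = (2 * l - 1) * w 1%N by move: E1; rewrite w21; lra.
  have : ((l - 1) * (6 * l ^+ 2 + 3 * l - 1)) * w 1%N = 0.
    have : l * (3 * l * w 0%N - 2 * w 1%N) = w 0%N by move: E0 E3; rewrite w21; nra.
    by rewrite w01; lra.
  move/eqP; rewrite !mulf_eq0 subr_eq0 => /orP[/orP[->//|->]|/eqP w1]; first by rewrite !orbT.
  case/eqP: wx; rewrite w1 mulr0 in w01; move: E0; rewrite w21 w1 w01 => E0.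
  by case: x xn => [|[|[|[|]]]] // _; lra.
case/or3P=> [/eqP->|/eqP->|/eqP lE]; first exact: walk_eigenvalue_const.
  apply/W; exists (fun k => nth 0 [:: 0; 1; -1; 0] k); split.
    by exists 1%N => //; exact: oner_neq0.
  by move=> [|[|[|[|]]]] //= _; rewrite !big_cons big_nil /=; lra.
(* The symmetric solution scaled by [l], so that the pendant value [w 0 / l] needs no division. *)
apply/W; exists (fun k => nth 0 [:: (2 * l - 1) * l; l; l; 2 * l - 1] k); split.
  by exists 1%N => //=; apply/eqP => l0; move: lE; rewrite l0; lra.
have lE3 : (l - 1) * (6 * l ^+ 2 + 3 * l - 1) = 0 by rewrite lE mulr0.
by move=> [|[|[|[|]]]] //= _; rewrite !big_cons big_nil /=; lra.
Qed.

Lemma walk_spectrum_U4_111 (R : rcfType) :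
  exists t : seq R, [/\ uniq t, size t = 4%N &
    forall l, walk_eigenvalue U4_111 l <-> l \in t].
Proof.
pose s : R := Num.sqrt 13; have s2 : s ^+ 2 = 13 by rewrite sqr_sqrtr // ler0n.
have s0 : 0 < s by rewrite sqrtr_gt0 ltr0n.
pose r1 := (-1 + s) / 6; pose r2 := (-1 - s) / 6.
have rE l : (l \in [:: r1; r2]) = (3 * l ^+ 2 + l - 1 == 0).
  have -> : 3 * l ^+ 2 + l - 1 = 3 * ((l - r1) * (l - r2)).
    by rewrite /r1 /r2; lra.
  by rewrite !inE !mulf_eq0 !subr_eq0 pnatr_eq0.
have W l := @walk_eigenvalue_nbrs R 5 U4_111 (fun x y => let s := [:: (0,1); (1,2); (0,2); (0,3); (1,4); (2,5)]%N in
  ((x, y) \in s) || ((y, x) \in s)) _ l (fun _ _ => erefl) erefl.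
exists [:: 1; - 3^-1; r1; r2]; split=> // [|l].
  rewrite cons_uniq in_cons rE cons_uniq rE /= inE !andbT negb_or -andbA.
  by apply/and4P; split; apply/eqP; rewrite /r1 /r2; lra.
rewrite 2!in_cons rE; split.
  case/W => w [[x xn wx] wE].
  have E0 := wE 0%N isT; have E1 := wE 1%N isT; have E2 := wE 2%N isT.
  have E3 := wE 3%N isT; have E4 := wE 4%N isT; have E5 := wE 5%N isT.
  move: E0 E1 E2 E3 E4 E5; rewrite /= !big_cons !big_nil !addr0 !mulr1.
  move=> E0 E1 E2 E3 E4 E5; rewrite E3 E4 E5 in E0 E1 E2.
  (* After eliminating the triangle through [w 0 = l * w 3] and its analogues, the system splits
     into differences and the sum of the leaf values. *)
  have F1 : (3 * l ^+ 2 + l - 1) * (w 3%N - w 4%N) = 0 by lra.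
  have F2 : (3 * l ^+ 2 + l - 1) * (w 4%N - w 5%N) = 0 by lra.
  have F3 : ((l - 1) * (l + 3^-1)) * (w 3%N + w 4%N + w 5%N) = 0 by lra.
  move/eqP: F3; rewrite !mulf_eq0 subr_eq0 addr_eq0 => /orP[/orP[->|->]|/eqP F3].
  - by [].
  - by rewrite orbT.
  move/eqP: F1; rewrite mulf_eq0 => /orP[->|/eqP F1]; first by rewrite !orbT.
  move/eqP: F2; rewrite mulf_eq0 => /orP[->|/eqP F2]; first by rewrite !orbT.
  have w3 : w 3%N = 0 by lra.
  have w4 : w 4%N = 0 by lra.
  have w5 : w 5%N = 0 by lra.
  case/eqP: wx; move: x xn => [|[|[|[|[|[|]]]]]] // _;
    by rewrite ?E3 ?E4 ?E5 ?w3 ?w4 ?w5 ?mulr0.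
case/or3P=> [/eqP->|/eqP->|/eqP lE]; first exact: walk_eigenvalue_const.
  apply/W; exists (fun k => nth 0 [:: - 3^-1; - 3^-1; - 3^-1; 1; 1; 1] k); split.
    by exists 3%N => //; exact: oner_neq0.
  by move=> [|[|[|[|[|[|]]]]]] //= _; rewrite !big_cons big_nil /=; lra.
apply/W; exists (fun k => nth 0 [:: l; - l; 0; 1; -1; 0] k); split.
  by exists 3%N => //; exact: oner_neq0.
by move=> [|[|[|[|[|[|]]]]]] //= _; rewrite !big_cons big_nil /=; lra.
Qed.

(** * Assembling the classification *)

(** An isolated vertex of a connected graph is its only vertex, so the degree sum would be 0 instead
    of [2 * n]. *)
Lemma unicyclic_deg_gt0 (n : nat) (e : rel 'I_n) :
  unicyclic e -> forall x, (0 < deg e x)%N.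
Proof.
move=> [es [econ eE]] x; rewrite lt0n; apply/eqP => dx0.
have isol y : e x y = false.
  by apply/negP => xy; have := cards0_eq dx0 => /setP/(_ y); rewrite !inE xy.
have all y : y = x.
  by have /connectP[[|w p] /=] := econ x y; [move=> _ -> | rewrite isol].
have := handshake es; rewrite eE big1 => [E|y _]; last by rewrite (all y).
by have := ltn_ord x; lia.
Qed.

Lemma num_distinct_iso (R : rcfType) (n m k : nat) (e : rel 'I_n) (e' : rel 'I_m) :
  symmetric e -> (forall x, (0 < deg e x)%N) -> graph_iso e e' ->
  (exists t : seq R, [/\ uniq t, size t = k &
    forall l, walk_eigenvalue e' l <-> l \in t]) ->
  num_distinct_eigenvalues_eq (norm_lap R e) k.
Proof.
move=> esym dpos iso [t [ut st tP]]; apply: (num_distinct_walk esym dpos ut st) => l.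
rewrite -tP; split; apply: walk_eigenvalue_iso => //.
exact: graph_iso_sym.
Qed.

Theorem theorem4p2 (R : rcfType) (n : nat) (e : rel 'I_n) :
  unicyclic e ->
  (num_distinct_eigenvalues_eq (norm_lap R e) 4 <->
   [\/ graph_iso e (@cycle_graph 6), graph_iso e (@cycle_graph 7),
       graph_iso e U2_1 | graph_iso e U4_111]).
Proof.
move=> uni; have dpos := unicyclic_deg_gt0 uni; have [es [econ eE]] := uni.
have [esym eirr] := es; have dsum := handshake es; rewrite eE in dsum.
split=> [e4|].
  have [a [b [c [K cub]]]] := walk_mx_cubic esym econ dpos e4.
  have [x /eqP dx|nl] := pickP [pred x | deg e x == 1%N].
    have [u xu _] := @nbr_notin _ e x [::] (dpos x).
    have := leaf_classification es dpos dsum cub (leaf_atP dx xu).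
    by case; [exact: Or43 | exact: Or44].
  (* Without leaves all degrees are at least 2, while their average is exactly 2. *)
  have d2 x : deg e x = 2%N.
    apply: (@sum_nat_tight _ predT (deg e)) => // [y _|].
      by have := dpos y; have := nl y; rewrite /=; case: (deg e y) => [|[]].
    by rewrite dsum sum1_card card_ord.
  (* The empty matrix has no eigenvector, hence no eigenvalue. *)
  have n0 : (0 < n)%N.
    case: n e e4 {uni dpos es econ eE esym eirr dsum cub nl d2} => // e [[|a0 s] [] // _ _ sP].
    have /eigenvalueP[u _] := (sP a0).2 (mem_head _ _).
    by rewrite thinmx0 eqxx.
  have [n3 iso] := two_regular_cycle es econ d2 n0.
  by case: (cycle_classification es dpos econ e4 n3 iso); [exact: Or41 | exact: Or42].
case=> iso; apply: (num_distinct_iso esym dpos iso).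
- exact: walk_spectrum_C6.
- exact: walk_spectrum_C7.
- exact: walk_spectrum_U2_1.
exact: walk_spectrum_U4_111.
Qed.
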